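(* Let $\lambda\in\sigma_{ess}(H_0)$ be a semi-regular point, let $H_0$ be resonant at $\lambda$, and let $V=F^*JF$ be a regular direction at $H_0$ with property $S$. Put $\tilde J=JP_{\lambda+i0}(H_0,V)$ and $\tilde V=F^*\tilde JF$. Then the direction $V-\tilde V$ is not regular at $H_0$.
   Context: Let $\mathcal H,\mathcal K$ be complex Hilbert spaces and $F\colon\mathcal H\to\mathcal K$ a closed densely defined operator with trivial kernel and dense range (a rigging). Let $\mathcal A_0=\{F^*JF: J=J^*\in\mathcal B(\mathcal K)\}$, a real Banach space with norm $\|F^*JF\|=\|J\|$; its elements are called directions. $H_0$ is a self-adjoint operator on $\mathcal H$ such that $F$ is $|H_0|^{1/2}$-compact, and $\mathcal A=H_0+\mathcal A_0$ (sums understood as form sums, which are self-adjoint). For $H\in\mathcal A$ and non-real $z$, $T_z(H)$ is the bounded (compact) operator on $\mathcal K$ given by the closure of $F(H-z)^{-1}F^*$; $T_{\lambda\pm i0}(H)$ is the norm limit of $T_{\lambda\pm iy}(H)$ as $y\to0^+$, if it exists. $H\in\mathcal A$ is regular at $\lambda\in\mathbb R$ if $T_{\lambda+i0}(H)$ exists, and resonant at $\lambda$ otherwise. $\lambda$ is semi-regular if some $H\in\mathcal A$ is regular at $\lambda$. A direction $V=F^*JF$ is regular at $H\in\mathcal A$ (with respect to $\lambda$) if $T_{\lambda+i0}(H+rV)$ exists for some $r\in\mathbb R$. For such $V$, $r$ and complex $s$ set $T_{\lambda\pm i0}(H+sV)=[1+(s-r)T_{\lambda\pm i0}(H+rV)J]^{-1}T_{\lambda\pm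 i0}(H+rV)$ whenever the inverse exists; this is a meromorphic function of $s$, independent of $r$, agreeing with the limit for real $s$. Its poles are called resonance points. With $C(0)$ a small counterclockwise circle around $0$ enclosing no resonance points other than possibly $0$, put $$P_{\lambda\pm i0}(H,V)=\frac1{2\pi i}\oint_{C(0)}T_{\lambda\pm i0}(H+sV)J\,ds,$$ a finite-rank idempotent on $\mathcal K$, and $Q_{\lambda\pm i0}(H,V)=\frac1{2\pi i}\oint_{C(0)}JT_{\lambda\pm i0}(H+sV)\,ds$. The regular direction $V$ has property $S$ (at $H$, $\lambda$) if $Q_{\lambda-i0}(H,V)JP_{\lambda+i0}(H,V)=JP_{\lambda+i0}(H,V)$, equivalently if $JP_{\lambda+i0}(H,V)$ is self-adjoint. *)

(* Defs.v *)
(* R[i] is ordered by x <= y iff y - x is a nonnegative real; norms are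
   elements of R[i]. *)
From HB Require Import structures.
From mathcomp Require Import all_boot all_order all_algebra.
From mathcomp Require Import sesquilinear complex.
From mathcomp Require Import all_classical all_reals all_analysis.

Set Implicit Arguments.
Unset Strict Implicit.
Unset Printing Implicit Defensive.

Import Order.TTheory GRing.Theory Num.Theory.
Import numFieldNormedType.Exports.

Local Open Scope classical_set_scope.
Local Open Scope ring_scope.
Local Open Scope complex_scope.

(* [hdot] is linear in its first argument, conjugate-linear in the second. *)
HB.mixin Record CompleteNormedModule_isHilbert (R : realType) (H : Type)
    of CompleteNormedModule R[i] H := {
  hdot : {dot H for (Num.conj : R[i] -> R[i])} ;
  hdotE : forall u : H, hdot u u = `|u| ^+ 2 }.

#[short(type="hilbertType")]
HB.structure Definition Hilbert (R : realType) :=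
  { H of CompleteNormedModule R[i] H & CompleteNormedModule_isHilbert R H }.

(* An unbounded operator is represented by its graph, a set of pairs
   (argument, value). *)
Section Operators.
Context {R : realType}.
Local Notation C := (R[i]).
Implicit Types X Y Z : hilbertType R.

Definition bounded_op X Y (T : X -> Y) : Prop := linear T /\ continuous T.

Definition opnorm_le X Y (T : X -> Y) (c : C) : Prop :=
  forall x, `|T x| <= c * `|x|.

Definition op_graph X Y (T : X -> Y) : set (X * Y) := [set p | p.2 = T p.1].

Definition inverse_op X (T S : X -> X) : Prop :=
  [/\ bounded_op S, cancel T S & cancel S T].

Definition selfadjoint_bounded X (J : X -> X) : Prop :=
  bounded_op J /\ forall x y, hdot (J x) y = hdot x (J y).

Definition linear_operator X Y (G : set (X * Y)) : Prop :=
  [/\ G (0, 0),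
      forall (a : C) p q, G p -> G q -> G (a *: p + q) &
      forall x y1 y2, G (x, y1) -> G (x, y2) -> y1 = y2].

Definition op_dom X Y (G : set (X * Y)) : set X := fst @` G.

Definition op_range X Y (G : set (X * Y)) : set Y := snd @` G.

Definition adjoint X Y (G : set (X * Y)) : set (Y * X) :=
  [set p | forall q, G q -> hdot q.2 p.1 = hdot q.1 p.2].

Definition op_comp X Y Z (G2 : set (Y * Z)) (G1 : set (X * Y)) : set (X * Z) :=
  [set p | exists2 y, G1 (p.1, y) & G2 (y, p.2)].

Definition selfadjoint X (G : set (X * X)) : Prop :=
  [/\ linear_operator G, dense (op_dom G) & adjoint G = G].

Definition nonneg_op X (G : set (X * X)) : Prop :=
  forall p, G p -> 0 <= hdot p.2 p.1.

(* The graph of (G - z)^-1. *)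
Definition resolvent X (G : set (X * X)) (z : C) : set (X * X) :=
  [set p | G (p.2, p.1 + z *: p.2)].

Definition resolvent_set X (G : set (X * X)) : set C :=
  [set z | exists2 S, bounded_op S & resolvent G z = op_graph S].

Definition spectrum X (G : set (X * X)) : set C := ~` resolvent_set G.

Definition discrete_spectrum X (G : set (X * X)) : set C :=
  [set z | [/\ spectrum G z,
    (exists2 e : C, 0 < e &
       forall w, 0 < `|w - z| -> `|w - z| < e -> resolvent_set G w),
    (exists2 u, u != 0 & G (u, z *: u)) &
    (exists n (e : 'I_n -> X), forall u, G (u, z *: u) ->
       exists c : 'I_n -> C, u = \sum_(i < n) c i *: e i)]].

Definition essential_spectrum X (G : set (X * X)) : set C :=
  spectrum G `\` discrete_spectrum G.

(* A = |G| = (G^* G)^{1/2} *)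
Definition is_abs X (G A : set (X * X)) : Prop :=
  [/\ selfadjoint A, nonneg_op A & op_comp A A = op_comp (adjoint G) G].

Definition is_sqrt X (A B : set (X * X)) : Prop :=
  [/\ selfadjoint B, nonneg_op B & op_comp B B = A].

(* [U] is the partial isometry of the polar decomposition G = U |G|; for a
   self-adjoint G it is the sign of G. *)
Definition is_polar X (G A : set (X * X)) (U : X -> X) : Prop :=
  [/\ bounded_op U, G = op_comp (op_graph U) A & forall u, G (u, 0) -> U u = 0].

(* B = |G|^{1/2} and U = sgn G.  The form of a self-adjoint operator G has
   domain D(B), and maps (u, v) to <U B u, B v>. *)
Definition form_data X (G B : set (X * X)) (U : X -> X) : Prop :=
  exists A, [/\ is_abs G A, is_sqrt A B & is_polar G A U].

(* Relative compactness in the sense of Kato. *)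
Definition rel_compact X Y (F : set (X * Y)) (B : set (X * X)) : Prop :=
  op_dom B `<=` op_dom F /\
  forall (u b : nat -> X) (f : nat -> Y) (M : C),
    (forall n, [/\ B (u n, b n), F (u n, f n), `|u n| <= M & `|b n| <= M]) ->
    exists2 phi : nat -> nat, {homo phi : m n / (m < n)%N} & cvgn (f \o phi).

End Operators.

Section Rigging.
Context {R : realType} {H K : hilbertType R}.
Local Notation C := (R[i]).
Implicit Types (F : set (H * K)) (G B : set (H * H)) (U : H -> H).
Implicit Types (J T P Q : K -> K) (lam r : R) (s z : C) (up : bool).

Definition rigging F : Prop :=
  [/\ linear_operator F, closed F, dense (op_dom F),
      forall u, F (u, 0) -> u = 0 & dense (op_range F)].

(* The direction F^* J F is represented by J. *)
Definition direction J : Prop := selfadjoint_bounded J.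

(* The form sum of H_0 and F^* J F, where B = |H_0|^{1/2} and U = sgn H_0: the
   operator associated with the form <U B u, B v> + <J F u, F v>, u, v in
   D(B) (and D(B) is contained in D(F) when F is B-compact). *)
Definition form_sum F B U J : set (H * H) :=
  [set p | exists b f, [/\ B (p.1, b), F (p.1, f) &
     forall v bv fv, B (v, bv) -> F (v, fv) ->
       hdot (U b) bv + hdot (J f) fv = hdot p.2 v]].

(* H_0 + r V *)
Definition perturbed F B U J r : set (H * H) :=
  form_sum F B U (fun x => r%:C *: J x).

(* T = T_z(G): the bounded operator which is the closure of F (G - z)^-1 F^*. *)
Definition is_Tz F G z T : Prop :=
  bounded_op T /\
  closure (op_comp F (op_comp (resolvent G z) (adjoint F))) = op_graph T.

(* T = T_{lam + i0}(G) if [up], T = T_{lam - i0}(G) otherwise. *)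
Definition is_Tlim F G lam up T : Prop :=
  bounded_op T /\
  forall e : C, 0 < e -> \forall y \near (0 : R)^'+,
    exists2 Ty, is_Tz F G (lam +i* (if up then y else - y)) Ty &
      opnorm_le (fun x => Ty x - T x) e.

Definition regular_at F G lam : Prop := exists T, is_Tlim F G lam true T.

Definition resonant_at F G lam : Prop := ~ regular_at F G lam.

Definition semi_regular F B U lam : Prop :=
  exists2 J, direction J & regular_at F (form_sum F B U J) lam.

(* Regularity at H_0 of the direction F^* J F. *)
Definition regular_direction F B U lam J : Prop :=
  exists r, regular_at F (perturbed F B U J r) lam.

(* With T = T_{lam +- i0}(H_0 + r V), the relation X = T_{lam +- i0}(H_0 + s V)
   for complex s. *)
Definition continuation T J r s (X : K -> K) : Prop :=
  exists2 S, inverse_op (fun x => x + (s - r%:C) *: T (J x)) S & X = S \o T.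

(* A pole of a partial operator-valued function, given by its graph. *)
Definition pole (f : C -> (K -> K) -> Prop) (s0 : C) : Prop :=
  forall M : C, 0 < M -> exists2 d : C, 0 < d &
    forall s, 0 < `|s - s0| -> `|s - s0| < d ->
      exists2 X, f s X & ~ opnorm_le X M.

Definition circle (rho t : R) : C := (rho * cos t) +i* (rho * sin t).

(* I is the integral of f over the circle of centre 0 and radius rho,
   counterclockwise: the limit in operator norm of the Riemann sums. *)
Definition is_circle_integral (f : C -> K -> K) (rho : R) (I : K -> K) : Prop :=
  bounded_op I /\
  forall e : C, 0 < e -> exists2 d : R, 0 < d &
    forall n (t tau : nat -> R),
      t 0%N = 0 -> t n = 2 * pi ->
      (forall k, (k < n)%N ->
         [/\ t k <= tau k, tau k <= t k.+1 & t k.+1 - t k < d]) ->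
      opnorm_le (fun x =>
        \sum_(k < n) (circle rho (t k.+1) - circle rho (t k))
           *: f (circle rho (tau k)) x - I x) e.

(* P = (2 pi i)^-1 \oint g(T_{lam +- i0}(H_0 + s V)) ds over a small circle
   around 0. *)
Definition is_residue F B U lam up J (g : (K -> K) -> (K -> K)) P : Prop :=
  exists r T (rho : R) (f : C -> K -> K) I,
    [/\ is_Tlim F (perturbed F B U J r) lam up T,
        0 < rho,
        (forall s, 0 < `|s| -> `|s| <= rho%:C -> ~ pole (continuation T J r) s),
        (forall s, `|s| = rho%:C -> continuation T J r s (f s)) &
        is_circle_integral (fun s => g (f s)) rho I /\
        P = (fun x => (2 * pi%:C * 'i)^-1 *: I x)].

Definition is_P F B U lam up J P : Prop :=
  is_residue F B U lam up J (fun X => X \o J) P.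

Definition is_Q F B U lam up J Q : Prop :=
  is_residue F B U lam up J (fun X => J \o X) Q.

Definition property_S F B U lam J : Prop :=
  exists P Q, [/\ is_P F B U lam true J P, is_Q F B U lam false J Q &
    Q \o J \o P = J \o P].

End Rigging.

(* Main.v *)
Require Import Defs.
From HB Require Import structures.
From mathcomp Require Import all_boot all_order all_algebra.
From mathcomp Require Import sesquilinear complex.
From mathcomp Require Import all_classical all_reals all_analysis.
From mathcomp Require Import ring lra.

Set Implicit Arguments.
Unset Strict Implicit.
Unset Printing Implicit Defensive.

Import Order.TTheory GRing.Theory Num.Theory.
Import numFieldNormedType.Exports.

Local Open Scope classical_set_scope.
Local Open Scope ring_scope.
Local Open Scope complex_scope.

Local Notation Re := complex.Re.
Local Notation Im := complex.Im.

(** Write [A = T J], where [T] is the boundary value of [H_0 + r V], and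
    [L = 1 - r A], which is invertible exactly when [H_0] is regular: the boundary value of
    [H_0] is then [L^-1 T] ([regular_of_inverse]). Suppose that [T'] is the boundary value of
    [H_0 + t (V - V~)]. The second resolvent identity passes to the limit
    ([limit_identity]) and shows that
      [W = 1 + T (t J (1 - P) - r J) = L + t A (1 - P)]
    has a bounded right inverse [Z]. Now [1 - P] is a multiple of [L] up to a small error: since
    [L (1 + (s - r) A)^-1 = 1 - s A (1 + (s - r) A)^-1], dividing by [2 pi i s] and integrating over
    the circle gives [L G = 1 - P], and a Riemann sum serves as [G] ([residue_parametrix]).
    Hence [W = L (1 + t A G)] up to a small error, and a Neumann series turns [Z] into a right
    inverse of [L] ([parametrix_right_inverse]). As [A] is compact, a surjective [L] is
    injective ([riesz_injective]), so [L] is invertible and [H_0] is regular at [lam], a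
    contradiction. Intuitively, [W] kills every eigenvector of [A] at [1/r], because [P] fixes it.

    The resolvent identity is obtained from the weak form of the equation
    [(H_0 + F^* J F - z) u = F^* f]. A weak solution [u] satisfies [F u = T_z f]
    ([weak_Tz]): both [T_z] and the weak solutions give graphs, and the graph of weak solutions
    is closable because [|Im z| |u|^2 <= |f| |F u|], a bound that rests on the form
    [<U B u, B u>] being real. Compactness of [T_z], and the equality of this form with
    [<H_0 u, v>], moreover need that [U] commutes with [B]. These facts on the polar
    decomposition ([form_dataP]) follow, without the spectral theorem, from one lemma on the
    Sylvester equation [G C + C G = 0] with [G >= 0] ([sylvester_symmetric]). *)

(** * Real inner products, norms and the topology *)

(** Norms and inner products take values in [R[i]]; their real and imaginary parts are what the
    arithmetic decision procedures for ordered fields can handle. *)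
Definition nrm (R : realType) (X : hilbertType R) (x : X) : R := Re `|x|.
Definition rip (R : realType) (X : hilbertType R) (x y : X) : R := Re (hdot x y).
Definition iip (R : realType) (X : hilbertType R) (x y : X) : R := Im (hdot x y).
Arguments nrm {R X}. Arguments rip {R X}. Arguments iip {R X}.

Section Basics.
Context {R : realType}.
Implicit Types X Y : hilbertType R.

Lemma hdotDl X (x y z : X) : hdot (x + y) z = hdot x z + hdot y z.
Proof. exact: linearDl. Qed.
Lemma hdotDr X (x y z : X) : hdot z (x + y) = hdot z x + hdot z y.
Proof. exact: linearDr. Qed.
Lemma hdotNl X (x z : X) : hdot (- x) z = - hdot x z.
Proof. exact: linearNl. Qed.
Lemma hdotNr X (x z : X) : hdot z (- x) = - hdot z x.
Proof. exact: linearNr. Qed.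
Lemma hdot0l X (z : X) : hdot 0 z = 0.
Proof. exact: linear0l. Qed.
Lemma hdot0r X (z : X) : hdot z 0 = 0.
Proof. exact: linear0r. Qed.
Lemma hdotZl X a (x z : X) : hdot (a *: x) z = a * hdot x z.
Proof. exact: linearZl_LR. Qed.
Lemma hdotZr X a (x z : X) : hdot z (a *: x) = a^* * hdot z x.
Proof. exact: linearZr_LR. Qed.
Lemma hdotC X (x y : X) : hdot y x = (hdot x y)^*.
Proof. by rewrite hermC /= expr0 mul1r. Qed.

Lemma hdot_inj X (x y : X) : (forall w, hdot x w = hdot y w) -> x = y.
Proof.
move=> h; apply/eqP; rewrite -subr_eq0 -normr_eq0 -sqrf_eq0 -hdotE.
by rewrite hdotDl h -hdotDl subrr hdot0l.
Qed.

Lemma nrmE X (x : X) : `|x| = (nrm x)%:C.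
Proof.
have := normr_ge0 x; rewrite /nrm; case: `|x| => a b /=.
by rewrite lecE /= => /andP[/eqP -> _].
Qed.

Lemma nrm_ge0 X (x : X) : 0 <= nrm x.
Proof. rewrite -lecR -nrmE; exact: normr_ge0. Qed.
Lemma nrm_eq0 X (x : X) : nrm x = 0 -> x = 0.
Proof. by move=> h; apply/eqP; rewrite -normr_eq0 nrmE h. Qed.
Lemma nrm0 X : nrm (0 : X) = 0.
Proof. by rewrite /nrm normr0. Qed.
Lemma nrmN X (x : X) : nrm (- x) = nrm x.
Proof. by rewrite /nrm normrN. Qed.
Lemma nrmBC X (x y : X) : nrm (x - y) = nrm (y - x).
Proof. by rewrite -nrmN opprB. Qed.
Lemma nrmD X (x y : X) : nrm (x + y) <= nrm x + nrm y.
Proof. by rewrite -lecR rmorphD /= -!nrmE; exact: ler_normD. Qed.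
Lemma nrmB X (x y : X) : nrm (x - y) <= nrm x + nrm y.
Proof. by rewrite -[nrm y]nrmN; exact: nrmD. Qed.
Lemma nrm_tri X (x y z : X) : nrm (x - z) <= nrm (x - y) + nrm (y - z).
Proof. by rewrite -[x - z](subrKA y); exact: nrmD. Qed.
Lemma nrmZ X a (x : X) : nrm (a *: x) = Normc.normc a * nrm x.
Proof.
apply: (@complexI R); rewrite -nrmE normrZ rmorphM /= -nrmE; congr (_ * _).
Qed.
Lemma nrmZr X (r : R) (x : X) : nrm (r%:C *: x) = `|r| * nrm x.
Proof. by rewrite nrmZ /= expr0n /= addr0 sqrtr_sqr. Qed.

Lemma ripDl X (x y z : X) : rip (x + y) z = rip x z + rip y z.
Proof. by rewrite /rip hdotDl raddfD. Qed.
Lemma ripDr X (x y z : X) : rip z (x + y) = rip z x + rip z y.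
Proof. by rewrite /rip hdotDr raddfD. Qed.
Lemma ripNl X (x z : X) : rip (- x) z = - rip x z.
Proof. by rewrite /rip hdotNl raddfN. Qed.
Lemma ripNr X (x z : X) : rip z (- x) = - rip z x.
Proof. by rewrite /rip hdotNr raddfN. Qed.
Lemma iipDl X (x y z : X) : iip (x + y) z = iip x z + iip y z.
Proof. by rewrite /iip hdotDl raddfD. Qed.
Lemma iipDr X (x y z : X) : iip z (x + y) = iip z x + iip z y.
Proof. by rewrite /iip hdotDr raddfD. Qed.
Lemma iipNl X (x z : X) : iip (- x) z = - iip x z.
Proof. by rewrite /iip hdotNl raddfN. Qed.
Lemma iipNr X (x z : X) : iip z (- x) = - iip z x.
Proof. by rewrite /iip hdotNr raddfN. Qed.
Lemma ripZl X a (x z : X) : rip (a *: x) z = Re a * rip x z - Im a * iip x z.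
Proof. by rewrite /rip /iip hdotZl; case: a (hdot x z) => [? ?] []. Qed.
Lemma iipZl X a (x z : X) : iip (a *: x) z = Re a * iip x z + Im a * rip x z.
Proof. by rewrite /rip /iip hdotZl; case: a (hdot x z) => [? ?] []. Qed.
Lemma ripC X (x y : X) : rip y x = rip x y.
Proof. by rewrite /rip hdotC; case: (hdot x y). Qed.
Lemma iipC X (x y : X) : iip y x = - iip x y.
Proof. by rewrite /iip hdotC; case: (hdot x y). Qed.
Lemma ripZr X a (x z : X) : rip z (a *: x) = Re a * rip z x + Im a * iip z x.
Proof. by rewrite ripC ripZl ripC (iipC z) mulrN opprK. Qed.
Lemma iipZr X a (x z : X) : iip z (a *: x) = Re a * iip z x - Im a * rip z x.
Proof. by rewrite iipC iipZl ripC (iipC z); ring. Qed.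
Lemma rip_nrm X (x : X) : rip x x = nrm x ^+ 2.
Proof. by rewrite /rip hdotE nrmE -rmorphXn. Qed.
Lemma iip_diag X (x : X) : iip x x = 0.
Proof. by rewrite /iip hdotE nrmE -rmorphXn. Qed.
Lemma hdot_eq X (x y : X) Y (x' y' : Y) :
  rip x y = rip x' y' -> iip x y = iip x' y' -> hdot x y = hdot x' y'.
Proof.
rewrite /rip /iip; case: (hdot x y) => a b; case: (hdot x' y') => c d /= -> ->.
by [].
Qed.

Definition ipE := (@ripDl, @ripDr, @ripNl, @ripNr, @iipDl, @iipDr, @iipNl,
  @iipNr, @ripZl, @ripZr, @iipZl, @iipZr, @rip_nrm, @iip_diag).

Lemma nrmD_sq X (x y : X) :
  nrm (x + y) ^+ 2 = nrm x ^+ 2 + 2 * rip x y + nrm y ^+ 2.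
Proof. by rewrite -!rip_nrm ripDl !ripDr (ripC x y); ring. Qed.
Lemma nrmB_sq X (x y : X) :
  nrm (x - y) ^+ 2 = nrm x ^+ 2 - 2 * rip x y + nrm y ^+ 2.
Proof. by rewrite nrmD_sq nrmN ripNr; ring. Qed.

Lemma rip_le X (x y : X) : `|rip x y| <= nrm x * nrm y.
Proof.
have [y0|ny0] := eqVneq (nrm y) 0.
  by rewrite (nrm_eq0 y0) /rip hdot0r normr0 nrm0 mulr0.
have yp : 0 < nrm y by rewrite lt_def ny0 nrm_ge0.
rewrite -ler_sqr ?nnegrE ?mulr_ge0 ?nrm_ge0 // real_normK ?num_real //.
have := sqr_ge0 (nrm (x - (rip x y / nrm y ^+ 2)%:C *: y)).
rewrite nrmB_sq ipE nrmZr exprMn real_normK ?num_real //= mul0r addr0.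
have -> : nrm x ^+ 2 - 2 * (rip x y / nrm y ^+ 2 * rip x y) +
  (rip x y / nrm y ^+ 2) ^+ 2 * nrm y ^+ 2 =
  ((nrm x * nrm y) ^+ 2 - rip x y ^+ 2) / nrm y ^+ 2 by field.
by rewrite pmulr_lge0 ?invr_gt0 ?exprn_gt0 // subr_ge0.
Qed.

Lemma iip_le X (x y : X) : `|iip x y| <= nrm x * nrm y.
Proof.
have := rip_le x ('i *: y).
by rewrite ipE /= mul0r add0r mul1r nrmZ /= expr0n expr1n add0r sqrtr1 mul1r.
Qed.

Lemma linear_bounded X Y (T : X -> Y) : bounded_op T ->
  exists2 c : R, 0 <= c & forall x, nrm (T x) <= c * nrm x.
Proof.
move=> [lT cT].
have T0 : T 0 = 0.
  by have := lT (-1) 0 0; rewrite scaler0 addr0 scaleN1r addNr.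
have TZ a x : T (a *: x) = a *: T x by have := lT a x 0; rewrite !addr0 T0 addr0.
have [d d0 hd] : exists2 d : R, 0 < d & forall x, nrm x < d -> nrm (T x) < 1.
  have /cvgrPdist_lt/(_ 1 ltr01)/nbhs_ballP[d /= d0 hd] := cT 0.
  have [d1 d10 dE] : exists2 d1 : R, 0 < d1 & d = d1%:C.
    case: d d0 {hd} => a b; rewrite ltcE /= => /andP[/eqP -> a0].
    by exists a.
  exists d1 => // x xd; have := hd x.
  rewrite -ball_normE /= sub0r normrN T0 sub0r normrN !nrmE dE.
  by rewrite !ltcR; apply.
exists (2 / d); first by rewrite divr_ge0 // ltW.
move=> x; have [->|nx0] := eqVneq x 0; first by rewrite T0 !nrm0 mulr0.
have xp : 0 < nrm x.
  by rewrite lt_def nrm_ge0 andbT; apply: contra nx0 => /eqP/nrm_eq0/eqP.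
have := hd ((d / (2 * nrm x))%:C *: x).
have dp : 0 <= d / (2 * nrm x) by rewrite divr_ge0 ?mulr_ge0 ?(ltW d0) ?nrm_ge0.
rewrite TZ !nrmZr ger0_norm //.
have -> : d / (2 * nrm x) * nrm x = d / 2 by field; rewrite gt_eqF.
have -> : d / (2 * nrm x) * nrm (T x) = nrm (T x) / (2 / d * nrm x).
  by field; rewrite !gt_eqF.
move=> h; have {}h : nrm (T x) / (2 / d * nrm x) < 1 by apply: h; lra.
have q0 : 0 < 2 / d * nrm x by rewrite mulr_gt0 ?divr_gt0.
by apply: ltW; rewrite -[ltRHS]mul1r -ltr_pdivrMr.
Qed.

Lemma bounded_continuous X Y (T : X -> Y) (c : R) :
  linear T -> (forall x, nrm (T x) <= c * nrm x) -> bounded_op T.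
Proof.
move=> lT hc; split=> // x; apply/cvgrPdist_lt => e e0.
have TB a : T x - T a = T (x - a).
  by rewrite [x - a]addrC -(scaleN1r a) lT scaleN1r addrC.
have [e1 e10 ->] : exists2 e1 : R, 0 < e1 & e = e1%:C.
  by case: e e0 => a b; rewrite ltcE /= => /andP[/eqP -> a0]; exists a.
have c1 : 0 < `|c| + 1 by rewrite ltr_wpDl.
apply/nbhs_ballP; exists (e1 / (`|c| + 1))%:C; first by rewrite /= ltcR divr_gt0.
move=> a; rewrite -ball_normE /= TB !nrmE !ltcR => h.
have := hc (x - a).
have : c * nrm (x - a) <= (`|c| + 1) * nrm (x - a).
  by rewrite ler_wpM2r ?nrm_ge0 // (le_trans (ler_norm c)) // lerDl.
by move: h; rewrite ltr_pdivlMr // mulrC => ? ? ?; lra.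
Qed.

Lemma pos_real (e : R[i]) : 0 < e -> exists2 d : R, 0 < d & e = d%:C.
Proof.
by case: e => a b; rewrite ltcE /= => /andP[/eqP -> a0]; exists a.
Qed.

Lemma ball_nrm X (x y : X) (e : R) : ball x e%:C y = (nrm (x - y) < e) :> Prop.
Proof. by rewrite -ball_normE /ball_ /= nrmE ltcR. Qed.

Lemma closureP X Y (S : set (X * Y)) (p : X * Y) : closure S p <->
  forall e : R, 0 < e -> exists q, [/\ S q, nrm (p.1 - q.1) < e & nrm (p.2 - q.2) < e].
Proof.
split=> [h e e0|h A].
  have [|q [Sq hq]] := h (ball p e%:C); first by apply: nbhsx_ballx; rewrite ltcR.
  exists q; case: hq; rewrite !ball_nrm; split=> //.
move=> /nbhs_ballP[_ /pos_real[d d0 ->] hd].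
have [q [Sq h1 h2]] := h d d0; exists q; split => //; apply: hd.
by split; rewrite ball_nrm.
Qed.

Lemma closed_graphP X Y (S : set (X * Y)) (p : X * Y) : closed S ->
  (forall e : R, 0 < e -> exists q, [/\ S q, nrm (p.1 - q.1) < e & nrm (p.2 - q.2) < e]) ->
  S p.
Proof. by move=> cS /closureP; exact: cS. Qed.

Lemma archimedean_lt (c e : R) : 0 < e -> exists n : nat, c / n.+1%:R < e.
Proof.
move=> e0; exists (Num.bound `|c / e|).
rewrite ltr_pdivrMr ?ltr0n // mulrC -ltr_pdivrMr //.
apply: le_lt_trans (ler_norm _) _; apply: lt_trans (archi_boundP _) _ => //.
by rewrite ltr_nat.
Qed.

Lemma complete_seq X (u : nat -> X) (c : R) :
  (forall n m, (n <= m)%N -> nrm (u n - u m) <= c / n.+1%:R) ->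
  exists l, forall n, nrm (u n - l) <= c / n.+1%:R.
Proof.
move=> hu.
have cu : cvgn u.
  apply: cauchy_cvg; apply: cauchy_exP => _ /pos_real[e e0 ->].
  have [n hn] := archimedean_lt c e0; exists (u n), n => // m /= nm.
  by rewrite ball_nrm; exact: le_lt_trans (hu _ _ nm) hn.
exists (limn u) => n; apply/ler_addgt0Pr => e e0.
have e20 : 0 < e%:C by rewrite ltcR.
have /cvgrPdist_lt/(_ _ e20)[N _ hN] := cu.
have := hN _ (leq_maxl N n); have := hu _ _ (leq_maxr N n).
rewrite /= nrmE ltcR => h1 h2.
have := nrm_tri (u n) (u (maxn N n)) (limn u).
rewrite (nrmBC (u (maxn N n)) (limn u)) => h3.
by apply: (le_trans h3); apply: lerD => //; exact: ltW.
Qed.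

Lemma cvgn_close X (u : nat -> X) (e : R) : cvgn u -> 0 < e ->
  exists N, forall n m, (N <= n)%N -> (N <= m)%N -> nrm (u n - u m) < e.
Proof.
move=> cu e0.
have e20 : 0 < (e / 2)%:C by rewrite ltcR divr_gt0.
have /cvgrPdist_lt/(_ _ e20)[N _ hN] := cu.
exists N => n m hn hm.
have := hN n hn; have := hN m hm; rewrite /= !nrmE !ltcR => h1 h2.
have := nrm_tri (u n) (limn u) (u m); rewrite (nrmBC (u n) (limn u)); lra.
Qed.

End Basics.

(** * Orthogonal projection *)

(* Vector identities are tested against all vectors, which makes them ring identities. *)
Ltac vec := apply: hdot_inj => ?;
  rewrite ?(hdotDl, hdotNl, hdotZl, hdot0l, scaler0, scale0r); ring.

Section Projection.
Context {R : realType}.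
Implicit Types X Y : hilbertType R.

Definition linear_subspace X (M : set X) : Prop :=
  M 0 /\ forall a x y, M x -> M y -> M (a *: x + y).

Definition adherent X (M : set X) : set X :=
  [set x | forall e : R, 0 < e -> exists2 m, M m & nrm (x - m) < e].

Lemma subspaceD X (M : set X) x y : linear_subspace M -> M x -> M y -> M (x + y).
Proof. by move=> [_ h] Mx My; have := h 1 x y Mx My; rewrite scale1r. Qed.
Lemma subspaceZ X (M : set X) a x : linear_subspace M -> M x -> M (a *: x).
Proof. by move=> [M0 h] Mx; have := h a x 0 Mx M0; rewrite addr0. Qed.
Lemma subspaceB X (M : set X) x y : linear_subspace M -> M x -> M y -> M (x - y).
Proof.
move=> sM Mx My; apply: subspaceD => //; rewrite -scaleN1r; exact: subspaceZ.
Qed.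

(** The first-order condition at a minimum: a quadratic that stays nonnegative has no linear
    term. *)
Lemma quadratic_zero (r q : R) : 0 <= q ->
  (forall t : R, 2 * t * r <= t ^+ 2 * q) -> r = 0.
Proof.
move=> q0 h; have q1 : 0 < q + 1 by lra.
have := h (r / (q + 1)).
have -> : 2 * (r / (q + 1)) * r = (2 * (q + 1) * r ^+ 2) / (q + 1) ^+ 2.
  by field; rewrite gt_eqF.
have -> : (r / (q + 1)) ^+ 2 * q = (q * r ^+ 2) / (q + 1) ^+ 2.
  by field; rewrite gt_eqF.
rewrite ler_pM2r ?invr_gt0 ?exprn_gt0 // => hr.
have r2 := sqr_ge0 r.
have h0 : (q + 2) * r ^+ 2 <= 0 by lra.
have : r ^+ 2 <= 0 by rewrite -(@pmulr_rle0 _ (q + 2)) //; lra.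
by rewrite real_exprn_even_le0 ?num_real //= => /eqP.
Qed.

Lemma minimizer_orthogonal X (M : set X) x l : linear_subspace M -> M l ->
  (forall m, M m -> nrm (x - l) <= nrm (x - m)) ->
  forall y, M y -> hdot (x - l) y = 0.
Proof.
move=> sM Ml hmin.
have key y : M y -> rip (x - l) y = 0.
  move=> My; apply: (@quadratic_zero _ (nrm y ^+ 2)); first exact: sqr_ge0.
  move=> t; have /hmin : M (l + t%:C *: y).
    by apply: subspaceD => //; exact: subspaceZ.
  rewrite -ler_sqr ?nnegrE ?nrm_ge0 // .
  have -> : x - (l + t%:C *: y) = (x - l) - t%:C *: y by rewrite opprD addrA.
  rewrite (nrmB_sq (x - l)) nrmZr exprMn.
  by rewrite real_normK ?num_real // ripZr /=; lra.
move=> y My; rewrite -(hdot0l (0 : X)); apply: hdot_eq.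
  by rewrite key // /rip hdot0l.
have := key _ (subspaceZ 'i sM My); rewrite ripZr /= /iip hdot0l /=; lra.
Qed.

(** A minimizing sequence is Cauchy by the parallelogram law. *)
Lemma projection X (M : set X) x : linear_subspace M -> adherent M `<=` M ->
  exists2 m, M m & forall y, M y -> hdot (x - m) y = 0.
Proof.
move=> sM cM.
pose S := [set nrm (x - m) ^+ 2 | m in M].
have S0 : S !=set0 by exists (nrm (x - 0) ^+ 2), 0 => //; case: sM.
have lbS : has_lbound S by exists 0 => _ [m _ <-]; exact: sqr_ge0.
pose d := inf S.
have dS m : M m -> d <= nrm (x - m) ^+ 2.
  by move=> Mm; apply: ge_inf => //; exists m.
have /choice[u hu] n : exists m, M m /\ nrm (x - m) ^+ 2 < d + n.+1%:R^-1 ^+ 2.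
  have [||_ [m Mm <-] hm] := @inf_adherent _ S (n.+1%:R^-1 ^+ 2) _ _.
  - by rewrite exprn_gt0 // invr_gt0 ltr0n.
  - by split.
  by exists m.
have invS n : 0 < n.+1%:R^-1 :> R by rewrite invr_gt0 ltr0n.
have [|l hl] := @complete_seq _ _ u 2.
  move=> n m nm; rewrite -ler_sqr ?nnegrE ?mulr_ge0 ?nrm_ge0 ?(ltW (invS n)) //.
  have [Mn hn] := hu n; have [Mm hm] := hu m.
  have /dS : M (2^-1%:C *: (u n + u m)) by apply: subspaceZ => //; exact: subspaceD.
  have -> : x - 2^-1%:C *: (u n + u m) = 2^-1%:C *: ((x - u n) + (x - u m)).
    have e : 2^-1%:C + 2^-1%:C = 1 :> R[i] by rewrite -rmorphD /=; congr (_%:C); lra.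
    rewrite -{1}[x]scale1r -e; vec.
  rewrite nrmZr exprMn ger0_norm ?invr_ge0 // nrmD_sq.
  have -> : u n - u m = (x - u m) - (x - u n) by vec.
  rewrite (nrmB_sq (x - u m)) (ripC (x - u m)).
  have : m.+1%:R^-1 ^+ 2 <= n.+1%:R^-1 ^+ 2 :> R.
    rewrite ler_sqr ?nnegrE ?(ltW (invS _)) // lef_pV2 ?posrE ?ltr0n //.
    by rewrite ler_nat.
rewrite exprMn; move: (n.+1%:R^-1) (m.+1%:R^-1) hn hm => p q hn hm; lra.
have Ml : M l.
  apply: cM => e e0; have [n hn] := archimedean_lt 2 e0.
  exists (u n); first by have [] := hu n.
  by rewrite nrmBC; exact: le_lt_trans (hl n) hn.
exists l => //; apply: minimizer_orthogonal => // m Mm.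
apply/ler_addgt0Pr => e e0; have [n hn] := archimedean_lt 3 e0.
have [Mn hun] := hu n.
have : nrm (x - u n) <= nrm (x - m) + n.+1%:R^-1.
  rewrite -ler_sqr ?nnegrE ?addr_ge0 ?nrm_ge0 ?(ltW (invS _)) //.
  rewrite sqrrD; have := dS _ Mm.
  have : 0 <= nrm (x - m) * n.+1%:R^-1 by rewrite mulr_ge0 ?nrm_ge0 ?(ltW (invS _)).
  move: (n.+1%:R^-1) hun => p hun; lra.
have := nrm_tri x (u n) l; have := hl n.
move: (n.+1%:R^-1) hn => p hn; lra.
Qed.

Lemma adherent_subspace X (M : set X) : linear_subspace M -> linear_subspace (adherent M).
Proof.
move=> sM; split; first by move=> e e0; exists 0; [case: sM|rewrite subrr nrm0].
move=> a x y hx hy e e0.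
have a1 : 0 < Normc.normc a + 1.
  by rewrite ltr_wpDl // /Normc.normc; case: a => ? ?; exact: sqrtr_ge0.
have e2 : 0 < e / 2 by rewrite divr_gt0.
have [m Mm hm] := hx (e / 2 / (Normc.normc a + 1)) (divr_gt0 e2 a1).
have [k Mk hk] := hy _ e2.
exists (a *: m + k); first by case: sM => _; apply.
have -> : a *: x + y - (a *: m + k) = a *: (x - m) + (y - k) by vec.
apply: le_lt_trans (nrmD _ _) _; rewrite nrmZ.
move: hm; rewrite ltr_pdivlMr // mulrDr mulr1 [_ * Normc.normc a]mulrC.
have := nrm_ge0 (x - m); lra.
Qed.

Lemma adherent_closed X (M : set X) : adherent (adherent M) `<=` adherent M.
Proof.
move=> x hx e e0; have e2 : 0 < e / 2 by rewrite divr_gt0.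
have [y hy h1] := hx _ e2; have [z Mz h2] := hy _ e2.
by exists z => //; have := nrm_tri x y z; lra.
Qed.

Lemma orthogonal_adherent X (M : set X) : linear_subspace M ->
  (forall y, (forall m, M m -> hdot m y = 0) -> y = 0) -> forall x, adherent M x.
Proof.
move=> sM h x.
have [m Mm hm] := projection x (adherent_subspace sM) (@adherent_closed _ _).
suff -> : x = m by [].
apply/eqP; rewrite -subr_eq0; apply/eqP; apply: h => k Mk.
rewrite hdotC hm ?conjc0 // => e e0; exists k => //.
by rewrite subrr nrm0.
Qed.

(** A closed linear relation that is bounded below, and whose range has no
    nonzero orthogonal vector, has full range: the range is dense, and the lower
    bound turns an approximation of a value into a Cauchy sequence of arguments. *)
Lemma bounded_below_surjective X Y (L : set (X * Y)) (c : R) :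
  L (0, 0) -> (forall a p q, L p -> L q -> L (a *: p + q)) ->
  (forall p, (forall e : R, 0 < e ->
     exists q, [/\ L q, nrm (p.1 - q.1) < e & nrm (p.2 - q.2) < e]) -> L p) ->
  (forall p, L p -> nrm p.1 <= c * nrm p.2) ->
  (forall y, (forall p, L p -> hdot p.2 y = 0) -> y = 0) ->
  forall y, exists x, L (x, y).
Proof.
move=> L0 LD cL hc hort y.
have c0 : 0 <= `|c| by [].
have {}hc p : L p -> nrm p.1 <= `|c| * nrm p.2.
  by move=> /hc h; apply: (le_trans h); rewrite ler_wpM2r ?nrm_ge0 ?ler_norm.
have sM : linear_subspace [set p.2 | p in L].
  split; first by exists (0, 0).
  move=> a _ _ [p Lp <-] [q Lq <-]; exists (a *: p + q) => //; exact: LD.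
have aM := orthogonal_adherent sM _ y.
have {}aM : adherent [set p.2 | p in L] y.
  by apply: aM => z hz; apply: hort => p Lp; apply: hz; exists p.
have invS n : 0 < n.+1%:R^-1 :> R by rewrite invr_gt0 ltr0n.
have /choice[u hu] n : exists p, L p /\ nrm (y - p.2) < n.+1%:R^-1.
  by have [_ [p Lp <-] h] := aM _ (invS n); exists p.
have [|l hl] := @complete_seq _ _ (fun n => (u n).1) (2 * `|c|).
  move=> n m nm; have [Ln hn] := hu n; have [Lm hm] := hu m.
  have : L (u n - u m) by rewrite addrC -scaleN1r; exact: LD.
  move=> /hc /=; move=> h; apply: (le_trans h).
  rewrite -mulrA [leRHS]mulrCA ler_wpM2l //.
  have : m.+1%:R^-1 <= n.+1%:R^-1 :> R.
    by rewrite lef_pV2 ?posrE ?ltr0n // ler_nat.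
  have := nrm_tri (u n).2 y (u m).2; rewrite (nrmBC (u n).2 y).
  move: (n.+1%:R^-1) (m.+1%:R^-1) hn hm => p q hn hm; lra.
exists l; apply: cL => e e0 /=.
have [n hn] := archimedean_lt (2 * `|c| + 1) e0; have [Ln hun] := hu n.
exists (u n); split => //.
  rewrite nrmBC; apply: le_lt_trans (hl n) (le_lt_trans _ hn).
  by rewrite ler_wpM2r ?(ltW (invS _)) // lerDl.
apply: lt_le_trans hun (le_trans _ (ltW hn)).
by rewrite -[leLHS]mul1r ler_wpM2r ?(ltW (invS _)) // lerDr mulr_ge0.
Qed.

End Projection.

(** * Graphs of operators and the Sylvester equation *)

Section Operators.
Context {R : realType}.
Implicit Types X Y : hilbertType R.

Section Graph.
Context {X Y : hilbertType R} {G : set (X * Y)} (lG : linear_operator G).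

Lemma graph0 : G (0, 0). Proof. by case: lG. Qed.
Lemma graphP a x y x' y' : G (x, y) -> G (x', y') -> G (a *: x + x', a *: y + y').
Proof. by case: lG => _ h _; exact: h. Qed.
Lemma graphZ a x y : G (x, y) -> G (a *: x, a *: y).
Proof. by move=> h; have := graphP a h graph0; rewrite !addr0. Qed.
Lemma graphB x y x' y' : G (x, y) -> G (x', y') -> G (x - x', y - y').
Proof.
move=> h h'; have := graphP (-1) h' h.
by rewrite !scaleN1r (addrC _ x) (addrC _ y).
Qed.
Lemma graph_fun x y y' : G (x, y) -> G (x, y') -> y = y'.
Proof. by case: lG => _ _; apply. Qed.
End Graph.

Section Bounded.
Context {X Y : hilbertType R} {T : X -> Y} (bT : bounded_op T).
Lemma boundP a x y : T (a *: x + y) = a *: T x + T y.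
Proof. by case: bT => l _; exact: l. Qed.
Lemma boundD x y : T (x + y) = T x + T y.
Proof. by rewrite -[x]scale1r boundP !scale1r. Qed.
Lemma bound0 : T 0 = 0.
Proof. by have := boundP (-1) 0 0; rewrite scaler0 addr0 scaleN1r addNr. Qed.
Lemma boundZ a x : T (a *: x) = a *: T x.
Proof. by rewrite -[a *: x]addr0 boundP bound0 addr0. Qed.
Lemma boundN x : T (- x) = - T x.
Proof. by rewrite -(scaleN1r x) boundZ scaleN1r. Qed.
Lemma boundB x y : T (x - y) = T x - T y.
Proof. by rewrite boundD boundN. Qed.
End Bounded.

Lemma small_zero (r k : R) :
  (forall d : R, 0 < d -> d <= 1 -> `|r| <= d * k) -> r = 0.
Proof.
move=> h; apply/eqP; rewrite -normr_eq0 eq_le normr_ge0 andbT.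
apply/ler_addgt0Pr => d d0; rewrite add0r.
have k1 : 0 < `|k| + 1 by rewrite ltr_wpDl.
have m0 : 0 < Num.min 1 (d / (`|k| + 1)) by rewrite lt_min ltr01 divr_gt0.
apply: le_trans (h _ m0 _) _; first by rewrite ge_min lexx.
apply: (@le_trans _ _ (Num.min 1 (d / (`|k| + 1)) * (`|k| + 1))).
  by rewrite ler_wpM2l ?(ltW m0) //; have := ler_norm k; lra.
by rewrite -ler_pdivlMr // ge_min lexx orbT.
Qed.

Section Selfadjoint.
Context {X : hilbertType R} {G : set (X * X)} (sG : selfadjoint G).

Lemma sa_linear : linear_operator G. Proof. by case: sG. Qed.
Lemma sa_sym x y x' y' : G (x, y) -> G (x', y') -> hdot y x' = hdot x y'.
Proof. by case: sG => _ _ sE h; rewrite -{1}sE => /(_ (x, y) h). Qed.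
Lemma sa_max x' y' : (forall x y, G (x, y) -> hdot y x' = hdot x y') -> G (x', y').
Proof. by case: sG => _ _ sE h; rewrite -sE => -[x y]; exact: h. Qed.
Lemma sa_closed p : (forall e : R, 0 < e ->
  exists q, [/\ G q, nrm (p.1 - q.1) < e & nrm (p.2 - q.2) < e]) -> G p.
Proof.
case: p => x' y' h; apply: sa_max => x y xy; apply: hdot_eq; apply/eqP;
  rewrite -subr_eq0; apply/eqP; apply: (@small_zero _ (nrm y + nrm x)) => e e0 _;
  have [[a b] /= [Gab h1 h2]] := h e e0;
  have hs := sa_sym xy Gab.
- have -> : rip y x' - rip x y' = rip y (x' - a) - rip x (y' - b).
    by have : rip y a = rip x b := congr1 _ hs; rewrite !ipE; lra.
  apply: le_trans (ler_normB _ _) _; rewrite mulrDr; apply: lerD.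
    by apply: le_trans (rip_le _ _) _; rewrite mulrC ler_wpM2r ?nrm_ge0 ?ltW.
  by apply: le_trans (rip_le _ _) _; rewrite mulrC ler_wpM2r ?nrm_ge0 ?ltW.
- have -> : iip y x' - iip x y' = iip y (x' - a) - iip x (y' - b).
    by have : iip y a = iip x b := congr1 _ hs; rewrite !ipE; lra.
  apply: le_trans (ler_normB _ _) _; rewrite mulrDr; apply: lerD.
    by apply: le_trans (iip_le _ _) _; rewrite mulrC ler_wpM2r ?nrm_ge0 ?ltW.
  by apply: le_trans (iip_le _ _) _; rewrite mulrC ler_wpM2r ?nrm_ge0 ?ltW.
Qed.

End Selfadjoint.

(** Nonnegativity bounds [G + 1] below, and self-adjointness leaves nothing orthogonal to its
    range. *)
Lemma resolvent_exists X (G : set (X * X)) : selfadjoint G -> nonneg_op G ->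
  forall w, exists x, G (x, w - x).
Proof.
move=> sG pG; have lG := sa_linear sG.
apply: (@bounded_below_surjective _ _ _ [set p | G (p.1, p.2 - p.1)] 1) => /=.
- by rewrite subr0; exact: graph0.
- move=> a [x y] [x' y'] /= h h'.
  have -> : a *: y + y' - (a *: x + x') = a *: (y - x) + (y' - x') by vec.
  exact: graphP.
- move=> [x y] h; apply: (sa_closed sG) => e e0 /=.
  have [[a b] /= [h1 h2 h3]] := h (e / 2) (divr_gt0 e0 (ltr0Sn _ _)).
  exists (a, b - a); split => //=; first by lra.
  have -> : y - x - (b - a) = (y - b) - (x - a) by vec.
  have := nrmB (y - b) (x - a); lra.
- move=> [x y] /= /pG /=; rewrite lecE => /andP[_ /= h].
  have : rip (y - x) x + nrm x ^+ 2 <= nrm y * nrm x.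
    by rewrite -rip_nrm -ripDl subrK; have := rip_le y x; rewrite ler_norml => /andP[].
  rewrite /rip => h1; rewrite mul1r.
  have [->|nx] := eqVneq (nrm x) 0; first exact: nrm_ge0.
  by rewrite -(@ler_pM2r _ (nrm x)) ?lt_def ?nx ?nrm_ge0 //; lra.
- move=> y hy.
  have /pG /= : G (y, - y).
    apply: (sa_max sG) => x g xg; have := hy (x, g + x) => /=.
    rewrite addrK => /(_ xg); rewrite hdotDl hdotNr => /eqP.
    by rewrite addr_eq0 => /eqP.
  rewrite hdotNl hdotE oppr_ge0 nrmE -rmorphXn lecR => h.
  by apply: nrm_eq0; have := sqr_ge0 (nrm y) => h'; apply/eqP; rewrite -sqrf_eq0; apply/eqP; lra.
Qed.

Lemma bounded_multiples_zero (a b : R) : 0 <= a -> (forall n : nat, n%:R * a <= b) -> a = 0.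
Proof.
move=> a0 h; apply/eqP; rewrite eq_le a0 andbT leNgt; apply/negP => ap.
have [n hn] := archimedean_lt b ap; have := h n.+1.
by move: hn; rewrite ltr_pdivrMr ?ltr0n // mulrC => ? ?; lra.
Qed.

Lemma iip_adherent X (V : X -> X) (M : set X) e : bounded_op V -> adherent M e ->
  (forall m, M m -> iip (V m) m = 0) -> iip (V e) e = 0.
Proof.
move=> bV aM h; have [c c0 hc] := linear_bounded bV.
have key (d : R) : 0 < d -> d <= 1 -> `|iip (V e) e| <= d * (c * (2 * nrm e + 1)).
  move=> d0 d1; have [m Mm hm] := aM d d0.
  have -> : iip (V e) e = iip (V (e - m)) e + iip (V m) (e - m).
    by rewrite (boundB bV) !ipE (h _ Mm); ring.
  apply: le_trans (ler_normD _ _) _.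
  have h1 := iip_le (V (e - m)) e; have h2 := iip_le (V m) (e - m).
  have h3 := hc (e - m); have h4 := hc m.
  have h5 : nrm m <= nrm e + d.
    by have := nrmB e (e - m); rewrite subKr; lra.
  have n1 := nrm_ge0 e; have n2 := nrm_ge0 (e - m); have n3 := nrm_ge0 m.
  have h6 : nrm (V (e - m)) * nrm e <= c * d * nrm e.
    by rewrite ler_wpM2r // (le_trans h3) // ler_wpM2l // ltW.
  have h7 : nrm (V m) * nrm (e - m) <= c * (nrm e + 1) * d.
    rewrite ler_pM ?nrm_ge0 ?(ltW hm) // (le_trans h4) // ler_wpM2l //; lra.
  by lra.
exact: small_zero key.
Qed.

(** The Cayley transform [k = (1 - G) (1 + G)^-1] leaves [Im <V G x, G x>] unchanged when applied
    to [x], because the mixed terms cancel by hypothesis. It is a contraction with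
    [|w|^2 - |k w|^2 >= 8 |G x|^2] for [w = (1 + G)^2 x], and [8 c |G x|^2] dominates
    [8 |Im <V G x, G x>|]. The sum over [n] steps telescopes, so that letting [n] grow gives
    [Im <V G x, G x> = 0]. *)
Lemma sylvester_step X (G : set (X * X)) (V : X -> X) (c : R) :
  selfadjoint G -> nonneg_op G -> bounded_op V ->
  (forall x u g, G (x, u) -> G (u, g) -> iip (V u) g + iip (V g) u = 0) ->
  0 <= c -> (forall x, nrm (V x) <= c * nrm x) ->
  forall (n : nat) x x1 x2, G (x, x1) -> G (x1, x2) ->
    n%:R * (8 * `|iip (V x1) x1|) <= c * nrm (x + x1 + x1 + x2) ^+ 2.
Proof.
move=> sG pG bV hV c0 hc; have lG := sa_linear sG.
elim=> [|n IH] x x1 x2 G1 G2; first by rewrite mul0r mulr_ge0 // sqr_ge0.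
(* [u - u1] is the Cayley transform of [x = u + u1]. *)
have [u Gu] := resolvent_exists sG pG x.
pose u1 := x - u; pose u2 := x1 - u1; pose u3 := x2 - u2.
have Gu1 : G (u1, u2) by exact: graphB.
have Gu2 : G (u2, u3) by exact: graphB.
have [e1 e2 e3] : [/\ u1 = x - u, u2 = x1 - u1 & u3 = x2 - u2] by [].
rewrite -[x - u]/u1 in Gu; clearbody u1 u2 u3.
have := IH (u - u1) (u1 - u2) (u2 - u3) (graphB lG Gu Gu1) (graphB lG Gu1 Gu2).
have -> : u - u1 + (u1 - u2) + (u1 - u2) + (u2 - u3) = x - x2.
  by rewrite e3 e2 e1; vec.
have -> : iip (V (u1 - u2)) (u1 - u2) = iip (V x1) x1.
  have -> : x1 = u1 + u2 by rewrite e2; vec.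
  by have := hV _ _ _ Gu Gu1; rewrite (boundB bV) (boundD bV) !ipE; lra.
have hq : nrm (x + x1 + x1 + x2) ^+ 2 =
    nrm (x - x2) ^+ 2 + 4 * rip (x + x1) (x1 + x2).
  by rewrite -!rip_nrm !ipE (ripC x x1) (ripC x x2) (ripC x1 x2); ring.
have h12 : rip x x2 = nrm x1 ^+ 2 by rewrite -rip_nrm /rip (sa_sym sG G1 G2).
have p1 : 0 <= rip x1 x by have := pG _ G1; rewrite lecE => /andP[].
have p2 : 0 <= rip x2 x1 by have := pG _ G2; rewrite lecE => /andP[].
have hb : `|iip (V x1) x1| <= c * nrm x1 ^+ 2.
  apply: le_trans (iip_le _ _) _; rewrite expr2 mulrA ler_wpM2r ?nrm_ge0 //.
have : 8 * (c * nrm x1 ^+ 2) <= c * (4 * rip (x + x1) (x1 + x2)).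
  rewrite [leLHS]mulrCA ler_wpM2l // !ipE h12 (ripC x1 x) (ripC x2 x1); lra.
rewrite hq -natr1 mulrDl; lra.
Qed.

(** The last hypothesis says that [G V + V G] is symmetric, so the skew part [C] of
    [V] satisfies [G C + C G = 0]. For [G > 0] this forces [C = 0], as [G] and [- G] have
    disjoint spectra. The values [G x] on the domain of [G^2], together with the kernel of [G],
    span a dense subspace; [sylvester_step] handles the former, and the kernel hypotheses the
    latter. *)
Lemma sylvester_symmetric X (G : set (X * X)) (V : X -> X) :
  selfadjoint G -> nonneg_op G -> bounded_op V ->
  (forall y, G (y, 0) -> V y = 0) ->
  (forall x g y, G (x, g) -> G (y, 0) -> hdot (V g) y = 0) ->
  (forall x u g, G (x, u) -> G (u, g) -> iip (V u) g + iip (V g) u = 0) ->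
  forall e, iip (V e) e = 0.
Proof.
move=> sG pG bV hk hr hV e; have lG := sa_linear sG.
have [c c0 hc] := linear_bounded bV.
have zero x x1 x2 : G (x, x1) -> G (x1, x2) -> iip (V x1) x1 = 0.
  move=> G1 G2; have a0 : 0 <= 8 * `|iip (V x1) x1| by rewrite mulr_ge0.
  have := bounded_multiples_zero a0
    (fun n => sylvester_step sG pG bV hV c0 hc n G1 G2).
  by move/eqP; rewrite mulf_eq0 pnatr_eq0 /= normr_eq0 => /eqP.
pose M := [set m | exists x g g' y, [/\ G (x, g), G (g, g'), G (y, 0) & m = g + y]].
apply: (@iip_adherent _ V M) => //; last first.
  move=> _ [x [g [g' [y [G1 G2 Gy ->]]]]].
  rewrite (boundD bV) (hk _ Gy) addr0 iipDr (zero _ _ _ G1 G2).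
  by rewrite /iip (hr _ _ _ G1 Gy) addr0.
apply: orthogonal_adherent.
  split; first by exists 0, 0, 0, 0; split; rewrite ?addr0 //; exact: graph0.
  move=> a _ _ [x [g [g' [y [G1 G2 Gy ->]]]]] [x' [h [h' [y' [G1' G2' Gy' ->]]]]].
  exists (a *: x + x'), (a *: g + h), (a *: g' + h'), (a *: y + y'); split.
  - exact: graphP.
  - exact: graphP.
  - by have := graphP lG a Gy Gy'; rewrite scaler0 addr0.
  - by vec.
move=> v hv.
have [p Gp] := resolvent_exists sG pG v.
have [x Gx] := resolvent_exists sG pG p.
pose x1 := p - x; pose x2 := v - p - x1.
have Gx1 : G (x1, x2) by exact: graphB.
have vE : v = x + x1 + x1 + x2 by rewrite /x2 /x1; vec.
rewrite -[p - x]/x1 in Gx; clearbody x1 x2.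
have : rip x1 v = 0.
  rewrite /rip hv //; exists x, x1, x2, 0; split; rewrite ?addr0 //; exact: graph0.
rewrite vE !ipE.
have p1 : 0 <= rip x1 x by have := pG _ Gx; rewrite lecE => /andP[].
have p2 : 0 <= rip x2 x1 by have := pG _ Gx1; rewrite lecE => /andP[].
rewrite (ripC x2) => h0.
have x10 : x1 = 0.
  by apply: nrm_eq0; apply/eqP; rewrite -sqrf_eq0; apply/eqP; have := sqr_ge0 (nrm x1); lra.
have x20 : x2 = 0.
  by apply: (graph_fun lG (x := 0)); [rewrite -{1}x10|exact: graph0].
have vx : v = x by rewrite vE x20 x10 !addr0.
have : hdot (0 + v) v = 0.
  apply: hv; exists 0, 0, 0, v; split=> //; try exact: graph0.
  by rewrite vx -x10.
rewrite add0r hdotE => /eqP; rewrite sqrf_eq0 normr_eq0 => /eqP v0; by rewrite -vE.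
Qed.

End Operators.

(** * The polar decomposition commutes with the square root *)

Section Polar.
Context {R : realType} {X : hilbertType R}.

Lemma iip_zero_symmetric (V : X -> X) : bounded_op V ->
  (forall e, iip (V e) e = 0) -> forall e e', hdot (V e) e' = hdot e (V e').
Proof.
move=> bV h.
have key e e' : iip (V e) e' = iip e (V e').
  have := h (e + e'); rewrite (boundD bV) !ipE !h (iipC (V e') e); lra.
move=> e e'; apply: hdot_eq; last exact: key.
have := key e ('i *: e'); rewrite (boundZ bV) !ipE /=; lra.
Qed.

Lemma hdot_diag0 (x : X) : hdot x x = 0 -> x = 0.
Proof. by rewrite hdotE => /eqP; rewrite sqrf_eq0 normr_eq0 => /eqP. Qed.

Lemma real_iip0 (x y : X) : hdot x y = hdot y x -> iip x y = 0.
Proof. by move=> h; have := iipC x y; rewrite /iip h; lra. Qed.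

Section Resolvent.
Context {G : set (X * X)} (sG : selfadjoint G) (pG : nonneg_op G).

Lemma resolvent_unique x y w : G (x, w - x) -> G (y, w - y) -> x = y.
Proof.
move=> Gx Gy; have := pG (graphB (sa_linear sG) Gx Gy) => /=.
have -> : w - x - (w - y) = - (x - y) by vec.
rewrite hdotNl hdotE oppr_ge0 nrmE -rmorphXn lecR => h.
apply/eqP; rewrite -subr_eq0; apply/eqP/nrm_eq0/eqP; rewrite -sqrf_eq0.
by rewrite eq_le h sqr_ge0.
Qed.

Lemma resolvent_operator : exists2 E : X -> X, bounded_op E &
  forall x w, E w = x <-> G (x, w - x).
Proof.
have lG := sa_linear sG.
have [E hE] := choice (resolvent_exists sG pG).
exists E; last first.
  by move=> x w; split => [<-|h] //; apply: resolvent_unique (hE w) h.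
apply: (@bounded_continuous _ _ _ _ 1) => [a x y|w].
  apply: resolvent_unique (hE _) _.
  have -> : a *: x + y - (a *: E x + E y) = a *: (x - E x) + (y - E y) by vec.
  exact: graphP.
have := pG (hE w); rewrite lecE /= => /andP[_]; rewrite -/(rip _ _) !ipE => h1.
have := rip_le w (E w); rewrite ler_norml => /andP[_ h2]; rewrite mul1r.
have [->|nx] := eqVneq (nrm (E w)) 0; first exact: nrm_ge0.
by rewrite -(@ler_pM2r _ (nrm (E w))) ?lt_def ?nx ?nrm_ge0 //; lra.
Qed.
End Resolvent.


Context {H0 A B : set (X * X)} {U : X -> X}.
Hypotheses (sH : selfadjoint H0) (sA : selfadjoint A) (pA : nonneg_op A).
Hypotheses (sB : selfadjoint B) (pB : nonneg_op B) (bU : bounded_op U).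
Hypotheses (AA : op_comp A A = op_comp (adjoint H0) H0) (BB : op_comp B B = A).
Hypotheses (HU : H0 = op_comp (op_graph U) A) (kU : forall u, H0 (u, 0) -> U u = 0).

Lemma polar_value x a : A (x, a) -> H0 (x, U a).
Proof. by move=> h; rewrite HU; exists a. Qed.

Lemma polar_square x a g : A (x, a) -> A (a, g) -> H0 (U a, g).
Proof.
move=> h1 h2.
have : op_comp A A (x, g) by exists a.
rewrite AA; case=> h /= h3; case: sH => [_ _ ->] h4.
by rewrite (graph_fun (sa_linear sH) (polar_value h1) h3).
Qed.

Lemma abs_kernel y : A (y, 0) -> U y = 0.
Proof. by move=> /polar_value; rewrite (bound0 bU); exact: kU. Qed.

(** [sylvester_symmetric] with [G = |H_0|] and [V = U]: both terms in its hypothesis are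
    diagonal values of the symmetric operator [H_0], since [|H_0|^2 = H_0^2]. *)
Lemma polar_symmetric e e' : hdot (U e) e' = hdot e (U e').
Proof.
apply: iip_zero_symmetric => //; apply: (sylvester_symmetric sA pA bU).
- exact: abs_kernel.
- move=> x g y /polar_value Hx /polar_value; rewrite (bound0 bU) => Hy.
  by rewrite (sa_sym sH Hx Hy) hdot0r.
- move=> x u g Ax Au; have Hu := polar_square Ax Au.
  have Hu' := polar_value Au.
  by rewrite iipC (real_iip0 (sa_sym sH Hu Hu)) (real_iip0 (sa_sym sH Hu' Hu')); ring.
Qed.

Lemma polar_abs x a : A (x, a) -> A (U x, U a).
Proof.
move=> Ax; apply: (sa_max sA) => y a' Ay.
by rewrite -polar_symmetric (sa_sym sH (polar_value Ay) (polar_value Ax)).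
Qed.

Lemma sqrt_kernel y : A (y, 0) -> B (y, 0).
Proof.
rewrite -{1}BB => -[b /= B1 B2].
by have := sa_sym sB B1 B2; rewrite hdot0r => /hdot_diag0 b0; rewrite b0 in B1.
Qed.

(** With [E = (B + 1)^-1], the Sylvester lemma makes [U E] self-adjoint, that is, [U]
    commutes with the resolvent of [B]. *)
Lemma polar_sqrt x b : B (x, b) -> B (U x, U b).
Proof.
have lB := sa_linear sB.
have [E bE hE] := resolvent_operator sB pB.
have bUE : bounded_op (U \o E).
  case: bU => lU cU; case: bE => lE cE; split.
    by move=> a u v /=; rewrite lE lU.
  move=> u; apply: continuous_comp; [exact: cE|exact: cU].
have aux y b' a : A (y, a) -> iip (U y) (a + b') + iip (U b') (y + b') = 0.
  move=> Ay; have h1 : iip (U a) y = 0.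
    apply: real_iip0; have Hy := polar_value Ay.
    exact: (sa_sym sH Hy Hy).
  have h2 : iip (U b') b' = 0 by apply: real_iip0; rewrite polar_symmetric.
  have h3 : iip (U y) b' = iip y (U b') by rewrite /iip polar_symmetric.
  have h4 : iip (U y) a = iip y (U a) by rewrite /iip polar_symmetric.
  by rewrite !ipE h2 h3 h4 (iipC (U b') y) (iipC (U a) y) h1; ring.
have UE : forall e e', hdot (U (E e)) e' = hdot e (U (E e')).
  apply: (iip_zero_symmetric bUE); apply: (sylvester_symmetric sB pB bUE).
  - move=> y By; have -> : (U \o E) y = U y.
      by rewrite /=; congr U; apply/hE; rewrite subrr.
    by apply: abs_kernel; rewrite -BB; exists 0 => //=; exact: graph0.
  - move=> u g y Bu By; rewrite /= polar_symmetric.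
    rewrite (abs_kernel (_ : A (y, 0))) ?hdot0r //.
    by rewrite -BB; exists 0 => //=; exact: graph0.
  - move=> _ u g _ Bu /=.
    have By : B (E u, u - E u) by apply/hE.
    have Bb : B (u - E u, g - (u - E u)) by exact: graphB.
    have -> : E g = u - E u by apply/hE.
    have Ay : A (E u, g - (u - E u)) by rewrite -BB; exists (u - E u).
    by have := aux _ (u - E u) _ Ay; rewrite subrK [E u + _]addrC subrK.
move=> Bx; have Ex : E (x + b) = x by apply/hE; rewrite addrC addKr.
apply: (sa_max sB) => v bv Bv.
have Ev : E (v + bv) = v by apply/hE; rewrite addrC addKr.
have := UE (v + bv) (x + b); rewrite Ex Ev hdotDl hdotDr polar_symmetric.
by move=> /addrI <-; rewrite polar_symmetric.
Qed.

(** On the domain of [A^2] one has [A^2 = H_0^2 = (U A)^2 = U^2 A^2]. Every vector is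
    [(1 + A)^2 y] for such a [y], so [U^2 - 1] maps into the kernel of [A], which [B]
    annihilates. *)
Lemma polar_involutive x b : B (x, b) -> U (U b) = b.
Proof.
have lA := sa_linear sA; have lB := sa_linear sB.
have key w : B (U (U w) - w, 0).
  have [p /= Ap] := resolvent_exists sA pA w.
  have [y Ay] := resolvent_exists sA pA p.
  have Ay1 : A (p - y, w - p - (p - y)) by exact: graphB.
  have wE : w = y + (p - y) + (p - y) + (w - p - (p - y)) by vec.
  move: Ay Ay1 wE; move: (p - y) (w - p - (p - y)) => y1 y2 Ay Ay1 wE.
  have UU2 : U (U y2) = y2.
    have := polar_square Ay Ay1; rewrite HU => -[a /= A1 /= e].
    by rewrite -(graph_fun lA A1 (polar_abs Ay1)).
  have As : A (U (U y) - y, U (U y1) - y1) by apply: graphB => //; do 2!apply: polar_abs.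
  have As1 : A (U (U y1) - y1, 0).
    by rewrite -(subrr y2) -{1}UU2; apply: graphB => //; do 2!apply: polar_abs.
  have := sa_sym sA As As1; rewrite hdot0r => /hdot_diag0 s0.
  rewrite s0 in As; apply: sqrt_kernel.
  suff -> : U (U w) - w = U (U y) - y by [].
  rewrite {1}wE 3!(boundD bU) 3!(boundD bU) UU2.
  have -> : U (U y1) = y1 by apply/eqP; rewrite -subr_eq0 s0.
  by rewrite wE; vec.
move=> Bx; apply/eqP; rewrite -subr_eq0; apply/eqP.
apply: (graph_fun lB (x := U (U x) - x)) (key x).
by apply: graphB => //; do 2!apply: polar_sqrt.
Qed.

Lemma polar_form x h b v bv : H0 (x, h) -> B (x, b) -> B (v, bv) ->
  hdot (U b) bv = hdot h v.
Proof.
rewrite HU -{1}BB => -[a [/= b' B1 B2]]; rewrite /op_graph /= => -> Bx Bv.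
rewrite (graph_fun (sa_linear sB) Bx B1).
by rewrite (sa_sym sB (polar_sqrt B2) Bv).
Qed.

Lemma polar_domain x h : H0 (x, h) -> exists b, B (x, b).
Proof. by rewrite HU -{1}BB => -[a [/= b B1 _] _]; exists b. Qed.

End Polar.

(** [U] is a symmetry on the range of [B] that commutes with [B], and the form of [H_0] is the
    one associated with [B] and [U]. *)
Lemma form_dataP (R : realType) (X : hilbertType R) (H0 B : set (X * X)) (U : X -> X) :
  selfadjoint H0 -> form_data H0 B U ->
  [/\ selfadjoint B, bounded_op U, forall e e', hdot (U e) e' = hdot e (U e') &
  [/\ forall x b, B (x, b) -> B (U x, U b), forall x b, B (x, b) -> U (U b) = b,
      forall x h b v bv, H0 (x, h) -> B (x, b) -> B (v, bv) ->
        hdot (U b) bv = hdot h v &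
      forall x h, H0 (x, h) -> exists b, B (x, b)]].
Proof.
move=> sH [A [[sA pA AA] [sB pB BB] [bU HU kU]]].
split=> //; last split.
- exact: (polar_symmetric sH sA pA bU AA HU kU).
- exact: (polar_sqrt sH sA pA sB pB bU AA BB HU kU).
- exact: (polar_involutive sH sA pA sB pB bU AA BB HU kU).
- exact: (polar_form sH sA pA sB pB bU AA BB HU kU).
- exact: (polar_domain BB HU).
Qed.

(** * Weak solutions and the resolvent identity *)

(** [(H_0 + F^* J F - z) u = F^* eta] in the sense of forms, with [b = B u] and [k = F u]. Unlike
    the operator equation, it makes sense for [eta] outside the domain of [F^*], which is what
    the resolvent identity requires. *)
Definition weak_solution (R : realType) (H K : hilbertType R) (F : set (H * K))
    (B : set (H * H)) (U : H -> H) (J : K -> K) (z : R[i])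
    (eta : K) (u b : H) (k : K) : Prop :=
  [/\ B (u, b), F (u, k) &
    forall v bv fv, B (v, bv) -> F (v, fv) ->
      hdot (U b) bv + hdot (J k) fv = hdot eta fv + z * hdot u v].

Section Weak.
Context {R : realType} {H K : hilbertType R}.
Context {F : set (H * K)} {B : set (H * H)} {U : H -> H}.
Hypotheses (lF : linear_operator F) (cF : closed F) (lB : linear_operator B).
Hypotheses (bU : bounded_op U) (sU : forall e e', hdot (U e) e' = hdot e (U e')).
Local Notation weak := (weak_solution F B U).

Definition strong_solution (G : set (H * H)) z : set (K * K) :=
  op_comp F (op_comp (resolvent G z) (adjoint F)).

Lemma strong_solutionP G z f k : strong_solution G z (f, k) <->
  exists u g, [/\ forall v fv, F (v, fv) -> hdot g v = hdot f fv,
                  G (u, g + z *: u) & F (u, k)].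
Proof.
split=> [[u [g /= h1 h2] h3]|[u [g [h1 h2 h3]]]].
  exists u, g; split=> // v fv Fv.
  by rewrite hdotC (hdotC fv); congr (_^*); rewrite (h1 _ Fv).
exists u => //; exists g => //= -[v fv] Fv.
by rewrite /= hdotC (hdotC g) (h1 _ _ Fv).
Qed.

Lemma strong_weak J z f k : strong_solution (form_sum F B U J) z (f, k) ->
  exists u b, weak J z f u b k.
Proof.
move=> /strong_solutionP[u [g [hg [b [f' [/= Bu Fu h]] Fu']]]].
exists u, b; split=> // v bv fv Bv Fv.
by rewrite -(graph_fun lF Fu Fu') (h _ _ _ Bv Fv) hdotDl hdotZl (hg _ _ Fv).
Qed.

Lemma weak_perturb J J' z f u b k : weak J' z f u b k ->
  weak J z (f - (J' k - J k)) u b k.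
Proof.
move=> [Bu Fu h]; split=> // v bv fv Bv Fv.
rewrite !(hdotDl, hdotNl).
transitivity (hdot (U b) bv + hdot (J' k) fv - (hdot (J' k) fv - hdot (J k) fv)).
  ring.
by rewrite (h _ _ _ Bv Fv); ring.
Qed.

Lemma weakB J z f u b k f' u' b' k' : bounded_op J ->
  weak J z f u b k -> weak J z f' u' b' k' ->
  weak J z (f - f') (u - u') (b - b') (k - k').
Proof.
move=> bJ [Bu Fu h] [Bu' Fu' h']; split; try exact: graphB.
move=> v bv fv Bv Fv.
rewrite (boundB bU) (boundB bJ) !(hdotDl, hdotNl).
transitivity ((hdot (U b) bv + hdot (J k) fv) - (hdot (U b') bv + hdot (J k') fv)).
  ring.
by rewrite (h _ _ _ Bv Fv) (h' _ _ _ Bv Fv); ring.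
Qed.

(** The form is real on the diagonal, so only the term in [z] contributes to the
    imaginary part of the equation tested on its own solution. *)
Lemma weak_imaginary J z f u b k : direction J -> weak J z f u b k ->
  `|Im z| * nrm u ^+ 2 <= nrm f * nrm k.
Proof.
move=> [bJ sJ] [Bu Fu h].
have : Im z * nrm u ^+ 2 = - iip f k.
  have := congr1 (@complex.Im R) (h _ _ _ Bu Fu).
  rewrite !raddfD /= -/(iip _ _) -/(iip (J k) k) -/(iip f k).
  rewrite (real_iip0 (sU b b)) (real_iip0 (sJ k k)) hdotE nrmE -rmorphXn.
  by case: (z) => zr zi /=; lra.
move=> e; have := iip_le f k; rewrite -normrN -e normrM.
by rewrite [`|nrm u ^+ 2|]ger0_norm // sqr_ge0.
Qed.

(** Strong solutions approximate the point [(f, T f)] of the graph. Their difference with the given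
    weak solution has small datum, hence small [u] by [weak_imaginary], while [F] maps it
    close to [k - T f]; as [F] is closed, [k = T f]. *)
Lemma weak_Tz J z T f u b k : direction J -> Im z != 0 ->
  is_Tz F (form_sum F B U J) z T -> weak J z f u b k -> T f = k.
Proof.
move=> dJ z0 [bT hT] hw; have [bJ _] := dJ.
suff h0 : F (0, k - T f).
  by apply/esym/eqP; rewrite -subr_eq0; apply/eqP; exact: (graph_fun lF h0 (graph0 lF)).
have zp : 0 < `|Im z| by rewrite normr_gt0.
apply: closed_graphP => // e e0.
(* A strong solution at distance [d] will do, as [d q <= |Im z| e^2] makes [|u - u'| < e]. *)
pose q := nrm (k - T f) + 2.
have q0 : 0 < q by rewrite /q; have := nrm_ge0 (k - T f); lra.
pose d := Num.min 1 (Num.min e (`|Im z| * e ^+ 2 / q)).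
have d0 : 0 < d.
  by rewrite /d !lt_min ltr01 e0 divr_gt0 // mulr_gt0 // exprn_gt0.
have [d1 de dq] : [/\ d <= 1, d <= e & d * q <= `|Im z| * e ^+ 2].
  split; rewrite /d ?ge_min ?lexx ?orbT //.
  by rewrite -ler_pdivlMr // !ge_min lexx !orbT.
have : closure (strong_solution (form_sum F B U J) z) (f, T f).
  by rewrite /strong_solution hT.
move=> /closureP/(_ d d0)[[f' k'] /= [/strong_weak[u' [b' hw']] h1 h2]].
have hB := weakB bJ hw hw'; have [_ FB _] := hB.
exists (u - u', k - k'); split => //=.
  rewrite sub0r nrmN -(ltr_sqr) ?nnegrE ?nrm_ge0 ?ltW //.
  rewrite -(ltr_pM2l zp); apply: le_lt_trans (weak_imaginary dJ hB) _.
  apply: lt_le_trans dq.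
  have : nrm (k - k') <= nrm (k - T f) + d.
    by have := nrm_tri k (T f) k'; lra.
  move=> h3; apply: (@le_lt_trans _ _ (d * nrm (k - k'))).
    by rewrite ler_wpM2r ?nrm_ge0 // ltW.
  by rewrite ltr_pM2l // /q; lra.
have -> : k - T f - (k - k') = - (T f - k') by vec.
by rewrite nrmN; exact: lt_le_trans h2 de.
Qed.

Lemma nrm_small_zero (X : hilbertType R) (x : X) (c : R) :
  (forall d : R, 0 < d -> d <= 1 -> nrm x <= d * c) -> x = 0.
Proof.
move=> h; apply/nrm_eq0/(@small_zero _ _ c) => d d0 d1.
by rewrite ger0_norm ?nrm_ge0 //; exact: h.
Qed.

(** A solution for [J'] solves the weak equation for [J] with a shifted datum. As [weak_Tz]
    is applied to [J] only, [J'] may be any bounded operator. *)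
Lemma resolvent_identity J J' z T T' : direction J -> bounded_op J' -> Im z != 0 ->
  is_Tz F (form_sum F B U J) z T -> is_Tz F (form_sum F B U J') z T' ->
  forall f, T (f - (J' (T' f) - J (T' f))) = T' f.
Proof.
move=> dJ bJ' z0 hT [bT' hT'] f; have [bJ _] := dJ; have [bT _] := hT.
apply/eqP; rewrite -subr_eq0; apply/eqP.
have [c c0 hc] := linear_bounded bT; have [j j0 hj] := linear_bounded bJ.
have [j' j'0 hj'] := linear_bounded bJ'.
apply: (@nrm_small_zero _ _ (c * (1 + j' + j) + 1)) => d d0 _.
have : closure (strong_solution (form_sum F B U J') z) (f, T' f).
  by rewrite /strong_solution hT'.
move=> /closureP/(_ d d0)[[g k] /= [/strong_weak[u [b hw]] h1 h2]].
have := weak_Tz dJ z0 hT (weak_perturb J hw); move=> hk.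
have -> : T (f - (J' (T' f) - J (T' f))) - T' f =
   T ((f - g) - (J' (T' f - k) - J (T' f - k))) - (T' f - k).
  have -> : f - g - (J' (T' f - k) - J (T' f - k)) =
      f - (J' (T' f) - J (T' f)) - (g - (J' k - J k)).
    by rewrite (boundB bJ) (boundB bJ'); vec.
  by rewrite [T (_ - (g - _))](boundB bT) hk; vec.
apply: le_trans (nrmB _ _) _; rewrite mulrDr mulr1; apply: lerD; last exact: ltW.
apply: le_trans (hc _) _; rewrite mulrCA ler_wpM2l //.
apply: le_trans (nrmB _ _) _; have := nrmB (J' (T' f - k)) (J (T' f - k)).
have := hj (T' f - k); have := hj' (T' f - k).
have : j * nrm (T' f - k) <= j * d by rewrite ler_wpM2l // ltW.
have : j' * nrm (T' f - k) <= j' * d by rewrite ler_wpM2l // ltW.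
lra.
Qed.

Lemma Tlim_approx G G' lam T T' (e : R) :
  is_Tlim F G lam true T -> is_Tlim F G' lam true T' -> 0 < e ->
  exists y Ty Ty', [/\ 0 < y, is_Tz F G (lam +i* y) Ty, is_Tz F G' (lam +i* y) Ty',
    forall x, nrm (Ty x - T x) <= e * nrm x & forall x, nrm (Ty' x - T' x) <= e * nrm x].
Proof.
move=> [_ h] [_ h'] e0; have ec : 0 < e%:C by rewrite ltcR.
have h0 : \forall y \near (0 : R)^'+, 0 < y by exact: nbhs_right_gt.
have [y [y0 [[Ty h1 h2] [Ty' h3 h4]]]] :=
  filter_ex (filterI h0 (filterI (h _ ec) (h' _ ec))).
by exists y, Ty, Ty'; split => // x; rewrite -lecR rmorphM /= -!nrmE.
Qed.

Lemma limit_identity J J' lam T T' : direction J -> bounded_op J' ->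
  is_Tlim F (form_sum F B U J) lam true T ->
  is_Tlim F (form_sum F B U J') lam true T' ->
  forall f, T (f - (J' (T' f) - J (T' f))) = T' f.
Proof.
move=> dJ bJ' hT hT' f; have [bJ _] := dJ.
have [bT _] := hT; have [bT' _] := hT'.
apply/eqP; rewrite -subr_eq0; apply/eqP.
have [c c0 hc] := linear_bounded bT; have [j j0 hj] := linear_bounded bJ.
have [j' j'0 hj'] := linear_bounded bJ'.
pose x0 := f - (J' (T' f) - J (T' f)).
apply: (@nrm_small_zero _ _ (nrm x0 + (c + 1) * ((j' + j) * nrm f) + nrm f)) => d d0 d1.
have [y [S [S' [y0 hS hS' h h']]]] := Tlim_approx hT hT' d0.
have z0 : Im (lam +i* y) != 0 by rewrite /= gt_eqF.
have := resolvent_identity dJ bJ' z0 hS hS' f.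
have [bS _] := hS; set xy := f - _ => hxy.
have -> : T x0 - T' f = - (S x0 - T x0) + S (x0 - xy) + (S' f - T' f).
  by rewrite (boundB bS x0 xy) hxy; vec.
have hS1 x : nrm (S x) <= (c + 1) * nrm x.
  have := nrmD (S x - T x) (T x); rewrite subrK.
  have := h x; have := hc x.
  have : d * nrm x <= 1 * nrm x by rewrite ler_wpM2r ?nrm_ge0.
  lra.
apply: le_trans (nrmD _ _) _; rewrite !mulrDr; apply: lerD; last exact: h'.
apply: le_trans (nrmD _ _) _; rewrite nrmN; apply: lerD; first exact: h.
apply: le_trans (hS1 _) _; rewrite mulrCA ler_wpM2l ?addr_ge0 //.
have -> : x0 - xy = J' (S' f - T' f) - J (S' f - T' f).
  by rewrite /x0 /xy (boundB bJ') (boundB bJ); vec.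
apply: le_trans (nrmB _ _) _.
have := hj (S' f - T' f); have := hj' (S' f - T' f).
have : j * nrm (S' f - T' f) <= j * (d * nrm f) by rewrite ler_wpM2l.
have : j' * nrm (S' f - T' f) <= j' * (d * nrm f) by rewrite ler_wpM2l.
lra.
Qed.

End Weak.

(** * Compactness of the sandwiched resolvent *)

Section Compact.
Context {R : realType} {H K : hilbertType R}.
Context {F : set (H * K)} {B : set (H * H)} {U : H -> H}.
Hypotheses (lF : linear_operator F) (cF : closed F) (lB : linear_operator B).
Hypotheses (bU : bounded_op U) (sU : forall e e', hdot (U e) e' = hdot e (U e')).
Hypotheses (UB : forall x b, B (x, b) -> B (U x, U b)).
Hypotheses (UU : forall x b, B (x, b) -> U (U b) = b).
Hypothesis (cFB : rel_compact F B).
Local Notation weak := (weak_solution F B U).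

Lemma rel_compact_domain u b : B (u, b) -> exists f, F (u, f).
Proof.
case: cFB => h _ Bu; have [[v f] /= Fv <-] : op_dom F u by apply: h; exists (u, b).
by exists f.
Qed.

Lemma mono_ge (phi : nat -> nat) : {homo phi : m n / (m < n)%N} ->
  forall n, (n <= phi n)%N.
Proof. by move=> h; elim=> // n /leq_ltn_trans; apply; exact: h. Qed.

(** Otherwise some sequence bounded in the graph norm of [B] has [|F u_n| > n], which no
    subsequence with convergent image allows. *)
Lemma rel_compact_bounded : exists2 c : R, 0 <= c &
  forall u b f, B (u, b) -> F (u, f) -> nrm f <= c * (nrm b + nrm u).
Proof.
apply: contrapT => hn.
have hs (n : nat) : exists t : H * H * K,
    [/\ B (t.1.1, t.1.2), F (t.1.1, t.2), nrm t.1.1 <= 1, nrm t.1.2 <= 1 & n%:R < nrm t.2].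
  apply: contrapT => hn'; apply: hn; exists n%:R => // u b f Bu Fu.
  rewrite leNgt; apply/negP => hlt; apply: hn'.
  pose s := nrm b + nrm u.
  have s0 : 0 < s.
    rewrite lt_def addr_ge0 ?nrm_ge0 // andbT; apply/eqP => s0.
    have n1 := nrm_ge0 b; have n2 := nrm_ge0 u.
    have u0 : u = 0 by apply: nrm_eq0; rewrite /s in s0; lra.
    have f0 : f = 0.
      by apply: (graph_fun lF (x := 0)); [rewrite -{1}u0|exact: graph0].
    by move: hlt; rewrite -/s s0 mulr0 f0 nrm0 ltxx.
  exists ((s^-1)%:C *: u, (s^-1)%:C *: b, (s^-1)%:C *: f) => /=.
  rewrite !nrmZr gtr0_norm ?invr_gt0 // ![s^-1 * _]mulrC ltr_pdivlMr //.
  rewrite !ler_pdivrMr // !mul1r; split => //; try exact: graphZ.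
    by rewrite /s lerDr nrm_ge0.
  by rewrite /s lerDl nrm_ge0.
have [t ht] := choice hs.
have [_ /(_ (fun n => (t n).1.1) (fun n => (t n).1.2) (fun n => (t n).2) 1)] := cFB.
case=> [n|phi hphi cv].
  by have [? ? ? ? _] := ht n; rewrite !nrmE !lecR.
have [N hN] := cvgn_close cv ltr01.
have [n hn'] : exists n : nat, nrm (t (phi N)).2 + 1 < n%:R.
  by exists (Num.bound (nrm (t (phi N)).2 + 1)); apply: archi_boundP; rewrite addr_ge0 ?nrm_ge0.
pose m := maxn N n.
have := hN m N (leq_maxl _ _) (leqnn _) => /= h1.
have [_ _ _ _ h2] := ht (phi m).
have h3 : n%:R <= (phi m)%:R :> R.
  by rewrite ler_nat; apply: leq_trans (mono_ge hphi m); exact: leq_maxr.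
have := nrmD ((t (phi m)).2 - (t (phi N)).2) (t (phi N)).2; rewrite subrK; lra.
Qed.

Lemma le_of_sqr (x a b : R) : 0 <= a -> 0 <= b -> x ^+ 2 <= a + b * x -> x <= 1 + a + b.
Proof. by move=> a0 b0 h; rewrite leNgt; apply/negP => hx; nra. Qed.

(** The test vector [U u] turns the form into [<U B u, B U u> = |B u|^2]; the other terms are
    of lower order in [B u] as [F] is bounded relative to [B]. *)
Lemma weak_bound J z (M : R) : direction J -> Im z != 0 -> 0 <= M ->
  exists M' : R, forall f u b k, weak J z f u b k -> nrm f <= M -> nrm k <= M ->
    nrm u <= M' /\ nrm b <= M'.
Proof.
move=> dJ z0 M0; have [bJ _] := dJ.
have zp : 0 < `|Im z| by rewrite normr_gt0.
have [j j0 hj] := linear_bounded bJ; have [c c0 hc] := rel_compact_bounded.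
have [m m0 hm] := linear_bounded bU.
pose a1 := M ^+ 2 / `|Im z|; have a10 : 0 <= a1 by rewrite divr_ge0 ?sqr_ge0 ?ltW.
pose a := 1 + a1; have a0 : 0 <= a by rewrite /a; lra.
pose q := (M + j * M) * c.
have q0 : 0 <= q by rewrite mulr_ge0 // addr_ge0 ?mulr_ge0.
pose p := q * (m * a) + (`|Re z| + `|Im z|) * (a * (m * a)).
have ma0 := mulr_ge0 m0 a0.
have p0 : 0 <= p.
  have s0 : 0 <= `|Re z| + `|Im z| by exact: addr_ge0.
  exact: addr_ge0 (mulr_ge0 q0 ma0) (mulr_ge0 s0 (mulr_ge0 a0 ma0)).
exists (a + (1 + p + q)) => f u b k hw hf hk.
have ua : nrm u <= a.
  have -> : a = 1 + a1 + 0 by rewrite addr0.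
  apply: le_of_sqr => //; rewrite mul0r addr0 ler_pdivlMr // mulrC.
  by apply: le_trans (weak_imaginary sU dJ hw) _; rewrite expr2 ler_pM ?nrm_ge0.
suff bb : nrm b <= 1 + p + q by split; lra.
apply: le_of_sqr => //; have [Bu Fu h] := hw.
have [v Fv] := rel_compact_domain (UB Bu).
have := congr1 (@complex.Re R) (h _ _ _ (UB Bu) Fv).
have -> : hdot (U b) (U b) = hdot b b by rewrite sU (UU Bu).
have -> : complex.Re (hdot b b + hdot (J k) v) = nrm b ^+ 2 + rip (J k) v.
  by rewrite raddfD -rip_nrm.
have -> : complex.Re (hdot f v + z * hdot u (U u)) =
    rip f v + (Re z * rip u (U u) - Im z * iip u (U u)).
  by rewrite raddfD /= -/(rip f v) -ripZl -hdotZl.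
have Ub : nrm (U b) = nrm b.
  apply/eqP; by rewrite -(@eqrXn2 _ 2) ?nrm_ge0 // -!rip_nrm /rip sU (UU Bu).
have hv : nrm v <= c * (nrm b + m * a).
  apply: le_trans (hc _ _ _ (UB Bu) Fv) _; rewrite Ub ler_wpM2l // lerD2l.
  by apply: le_trans (hm u) _; rewrite ler_wpM2l.
have h1 : rip f v <= M * (c * (nrm b + m * a)).
  apply: le_trans (ler_norm _) (le_trans (rip_le _ _) _).
  by rewrite ler_pM ?nrm_ge0.
have h2 : - rip (J k) v <= (j * M) * (c * (nrm b + m * a)).
  rewrite -ripNl; apply: le_trans (ler_norm _) (le_trans (rip_le _ _) _).
  rewrite nrmN ler_pM ?nrm_ge0 //; apply: le_trans (hj k) _.
  by rewrite ler_wpM2l.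
have huU : nrm u * nrm (U u) <= a * (m * a).
  rewrite ler_pM ?nrm_ge0 //; apply: le_trans (hm u) _; by rewrite ler_wpM2l.
have h3 : Re z * rip u (U u) <= `|Re z| * (a * (m * a)).
  apply: le_trans (ler_norm _) _; rewrite normrM ler_wpM2l //.
  exact: le_trans (rip_le _ _) huU.
have h4 : - (Im z * iip u (U u)) <= `|Im z| * (a * (m * a)).
  apply: le_trans (ler_norm _) _; rewrite normrN normrM ler_wpM2l //.
  exact: le_trans (iip_le _ _) huU.
rewrite /p /q; lra.
Qed.

(** Compactness of [T] without limit points: this is all that the Riesz argument consumes, and it
    passes to norm limits without a diagonal argument. *)
Definition clustering (X Y : hilbertType R) (T : X -> Y) : Prop :=
  forall (e : nat -> X) (M d : R), (forall n, nrm (e n) <= M) -> 0 < d ->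
    exists n m, (n < m)%N /\ nrm (T (e m) - T (e n)) < d.

(** [T] is a norm limit of [T_z], and [T_z e] is a limit of vectors [F u] with [(u, B u)]
    bounded by [weak_bound]; relative compactness makes the latter cluster. *)
Lemma Tlim_clustering J lam T : direction J ->
  is_Tlim F (form_sum F B U J) lam true T -> clustering T.
Proof.
move=> dJ hT e M d heM d0; have [bT _] := hT.
have M0 : 0 <= M by exact: le_trans (nrm_ge0 _) (heM 0%N).
pose eps := d / (8 * (M + 1)).
have eps0 : 0 < eps by rewrite divr_gt0 // mulr_gt0 //; lra.
have [y [Ty [_ [y0 hTy _ hd _]]]] := Tlim_approx hT hT eps0.
have z0 : Im (lam +i* y) != 0 by rewrite /= gt_eqF.
have hde n : nrm (Ty (e n) - T (e n)) <= d / 8.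
  apply: le_trans (hd _) _; apply: (@le_trans _ _ (eps * (M + 1))).
    by rewrite ler_wpM2l ?(ltW eps0) //; have := heM n; lra.
  by rewrite le_eqVlt; apply/orP; left; apply/eqP; rewrite /eps; field; apply/lt0r_neq0; lra.
have [bTy hcl] := hTy; have [c c0 hc] := linear_bounded bTy.
pose r := Num.min 1 (d / 8).
have r0 : 0 < r by rewrite lt_min ltr01 divr_gt0.
have r1 : r <= 1 by rewrite ge_min lexx.
have rd : r <= d / 8 by rewrite ge_min lexx orbT.
have /choice[t ht] n : exists t : K * H * H * K,
    [/\ weak J (lam +i* y) t.1.1.1 t.1.1.2 t.1.2 t.2,
        nrm (e n - t.1.1.1) < r & nrm (Ty (e n) - t.2) < r].
  have : closure (strong_solution (F := F) (form_sum F B U J) (lam +i* y)) (e n, Ty (e n)).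
    by rewrite /strong_solution hcl.
  move=> /closureP/(_ r r0)[[f k] /= [/(strong_weak lF)[u [b hw]] h1 h2]].
  by exists (f, u, b, k).
pose M1 := M + 1 + (c * M + 1).
have M10 : 0 <= M1 by rewrite /M1 !addr_ge0 ?mulr_ge0.
have [M' hM'] := weak_bound dJ z0 M10.
have hb n : nrm (t n).1.1.2 <= M' /\ nrm (t n).1.2 <= M'.
  have [hw h1 h2] := ht n; apply: (hM' _ _ _ _ hw).
    have := nrmB (e n) (e n - (t n).1.1.1); rewrite subKr; have := heM n.
    by have := mulr_ge0 c0 M0; rewrite /M1; lra.
  have := nrmB (Ty (e n)) (Ty (e n) - (t n).2); rewrite subKr.
  have := hc (e n); have : c * nrm (e n) <= c * M by rewrite ler_wpM2l.
  by rewrite /M1; lra.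
have [_ /(_ (fun n => (t n).1.1.2) (fun n => (t n).1.2) (fun n => (t n).2) M'%:C)] := cFB.
case=> [n|phi hphi cv].
  by have [[? ? _] _ _] := ht n; have [? ?] := hb n; rewrite !nrmE !lecR.
have d4 : 0 < d / 4 by rewrite divr_gt0.
have [N hN] := cvgn_close cv d4.
exists (phi N), (phi N.+1); split; first exact: hphi.
have := hN N.+1 N (leqnSn _) (leqnn _) => /=.
have [_ _] := ht (phi N); have [_ _] := ht (phi N.+1).
have := hde (phi N); have := hde (phi N.+1).
move: (phi N) (phi N.+1) => n m h1 h2 h3 h4 h5.
have := nrm_tri (T (e m)) (Ty (e m)) (T (e n)).
have := nrm_tri (Ty (e m)) (t m).2 (T (e n)).
have := nrm_tri (t m).2 (t n).2 (T (e n)).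
have := nrm_tri (t n).2 (Ty (e n)) (T (e n)).
rewrite (nrmBC (T (e m)) (Ty (e m))) (nrmBC (t n).2 (Ty (e n))); lra.
Qed.

End Compact.

(** * Regularity and the Fredholm alternative *)

Lemma neumann (R : realType) (X : hilbertType R) (N : X -> X) : bounded_op N ->
  (forall x, nrm (N x) <= 2^-1 * nrm x) ->
  exists S, [/\ bounded_op S, forall x, S x - N (S x) = x,
    forall x, S (x - N x) = x & forall x, nrm (S x) <= 2 * nrm x].
Proof.
move=> bN hN.
have low x : nrm x <= 2 * nrm (x - N x).
  by have := nrmD (x - N x) (N x); rewrite subrK; have := hN x; lra.
have inj x y : x - N x = y - N y -> x = y.
  move=> e; apply/eqP; rewrite -subr_eq0; apply/eqP/nrm_eq0.
  have := low (x - y); rewrite (boundB bN).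
  have -> : x - y - (N x - N y) = (x - N x) - (y - N y) by vec.
  by rewrite e subrr nrm0; have := nrm_ge0 (x - y); lra.
have /choice[S hS] y : exists x, x - N x = y.
  have [||p p_cl||y' hy'|x /= xy] := @bounded_below_surjective _ _ _
    [set p : X * X | p.1 - N p.1 = p.2] 2 _ _ _ _ _ y; last by exists x.
  - by rewrite /= (bound0 bN) subr0.
  - move=> a [u u'] [v v'] /= <- <-; rewrite (boundP bN); vec.
  - case: p p_cl => u v /= h; apply/eqP; rewrite -subr_eq0; apply/eqP.
    apply: (@nrm_small_zero _ _ _ (2^-1 + 2)) => d d0 _.
    have [[u' v'] /= [<- h1 h2]] := h d d0.
    have -> : u - N u - v = (u - u') - N (u - u') - (v - (u' - N u')).
      by rewrite (boundB bN); vec.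
    have := nrmB (u - u' - N (u - u')) (v - (u' - N u')).
    have := nrmB (u - u') (N (u - u')); have := hN (u - u'); lra.
  - by move=> [u v] /= <-; exact: low.
  - have := hy' (y', y' - N y') erefl => /= h.
    have := congr1 (@complex.Re R) h; rewrite -/(rip _ _) !ipE /=.
    have := rip_le (N y') y'; rewrite ler_norml => /andP[_].
    have : nrm (N y') * nrm y' <= 2^-1 * nrm y' * nrm y'.
      by rewrite ler_wpM2r ?nrm_ge0.
    move=> h1 h2 h3; apply/nrm_eq0/eqP; rewrite -sqrf_eq0; apply/eqP.
    by have := sqr_ge0 (nrm y'); lra.
have bnd x : nrm (S x) <= 2 * nrm x by rewrite -{2}(hS x); exact: low.
exists S; split=> // [|x]; last by apply: inj; rewrite hS.
apply: (bounded_continuous (c := 2)) => // a x y.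
by apply: inj; rewrite hS (boundP bN) -{1}(hS x) -{1}(hS y); vec.
Qed.

Section BoundedOps.
Context {R : realType}.
Implicit Types X Y Z : hilbertType R.

Lemma bounded_id X : bounded_op (fun x : X => x).
Proof. by apply: (bounded_continuous (c := 1)) => // x; rewrite mul1r. Qed.

Lemma bounded_comp X Y Z (S : Y -> Z) (T : X -> Y) :
  bounded_op S -> bounded_op T -> bounded_op (fun x => S (T x)).
Proof.
move=> bS bT; have [c c0 hc] := linear_bounded bS; have [d d0 hd] := linear_bounded bT.
apply: (bounded_continuous (c := c * d)) => [a x y|x].
  by rewrite (boundP bT) (boundP bS).
by apply: le_trans (hc _) _; rewrite -mulrA ler_wpM2l.
Qed.

Lemma bounded_add X Y (S T : X -> Y) :
  bounded_op S -> bounded_op T -> bounded_op (fun x => S x + T x).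
Proof.
move=> bS bT; have [c c0 hc] := linear_bounded bS; have [d d0 hd] := linear_bounded bT.
apply: (bounded_continuous (c := c + d)) => [a x y|x].
  by rewrite (boundP bT) (boundP bS); vec.
by apply: le_trans (nrmD _ _) _; rewrite mulrDl lerD.
Qed.

Lemma bounded_scale X Y (a : R[i]) (T : X -> Y) :
  bounded_op T -> bounded_op (fun x => a *: T x).
Proof.
move=> bT; have [d d0 hd] := linear_bounded bT.
apply: (bounded_continuous (c := Normc.normc a * d)) => [b x y|x].
  by rewrite (boundP bT); vec.
by rewrite nrmZ -mulrA ler_wpM2l //; case: (a) => ? ?; exact: sqrtr_ge0.
Qed.

Lemma bounded_sub X Y (S T : X -> Y) :
  bounded_op S -> bounded_op T -> bounded_op (fun x => S x - T x).
Proof.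
move=> bS bT; have := bounded_add bS (bounded_scale (-1) bT).
by under [X in bounded_op X -> _]funext do rewrite scaleN1r.
Qed.

Lemma bounded_sum X Y (n : nat) (T : nat -> X -> Y) :
  (forall k, (k < n)%N -> bounded_op (T k)) ->
  bounded_op (fun x => \sum_(k < n) T k x).
Proof.
elim: n => [|n IH] h.
  apply: (bounded_continuous (c := 0)) => [a x y|x]; rewrite !big_ord0.
    by rewrite scaler0 addr0.
  by rewrite nrm0 mul0r.
under [X in bounded_op X]funext do rewrite big_ord_recr /=.
by apply: bounded_add; [apply: IH => k kn; apply: h; exact: ltnW|exact: h].
Qed.
End BoundedOps.

Lemma nonreal_resolvent (R : realType) (X : hilbertType R) (G : set (X * X)) (z : R[i]) :
  selfadjoint G -> Im z != 0 -> forall g, exists u, G (u, g + z *: u).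
Proof.
move=> sG z0; have lG := sa_linear sG.
have zp : 0 < `|Im z| by rewrite normr_gt0.
have n0 : 0 <= Normc.normc z by case: (z) => ? ?; exact: sqrtr_ge0.
apply: (@bounded_below_surjective _ _ _ [set p | G (p.1, p.2 + z *: p.1)] (`|Im z|^-1)).
- by rewrite /= scaler0 addr0; exact: graph0.
- move=> a [x y] [x' y'] /= h h'.
  have -> : a *: y + y' + z *: (a *: x + x') = a *: (y + z *: x) + (y' + z *: x') by vec.
  exact: graphP.
- move=> [x y] h; apply: (sa_closed sG) => e e0 /=.
  have q0 : 0 < Normc.normc z + 1 by lra.
  have [[a b] /= [h1 h2 h3]] := h _ (divr_gt0 e0 q0).
  exists (a, b + z *: a); split => //=.
    by apply: lt_le_trans h2 _; rewrite ler_pdivrMr // ler_peMr ?(ltW e0) // lerDr.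
  have -> : y + z *: x - (b + z *: a) = (y - b) + z *: (x - a) by vec.
  apply: le_lt_trans (nrmD _ _) _; rewrite nrmZ.
  have : e / (Normc.normc z + 1) * (Normc.normc z + 1) = e by rewrite divfK ?gt_eqF.
  have : Normc.normc z * nrm (x - a) <= Normc.normc z * (e / (Normc.normc z + 1)).
    by rewrite ler_wpM2l // ltW.
  lra.
- move=> [u g] /= Gu; rewrite mulrC ler_pdivlMr //.
  have := real_iip0 (sa_sym sG Gu Gu); rewrite !ipE => e.
  have e' : Im z * nrm u ^+ 2 = - iip g u by lra.
  have := iip_le g u; rewrite -normrN -e' normrM [`|_ ^+ 2|]ger0_norm ?sqr_ge0 //.
  have [->|nu] := eqVneq (nrm u) 0; first by rewrite mul0r nrm_ge0.
  by rewrite expr2 mulrA ler_pM2r ?lt_def ?nu ?nrm_ge0 // mulrC.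
- move=> y hy; have Gy : G (y, z^* *: y).
    apply: (sa_max sG) => u g Gu; have := hy (u, g - z *: u) => /=.
    rewrite subrK => /(_ Gu); rewrite hdotDl hdotNl hdotZl => /eqP.
    by rewrite subr_eq0 => /eqP ->; rewrite hdotZr; congr (_ * _); exact/esym/conjcK.
  have := real_iip0 (sa_sym sG Gy Gy); rewrite !ipE.
  have -> : Im z^* = - Im z by case: (z).
  move=> h; have /eqP : Im z * nrm y ^+ 2 = 0 by lra.
  by rewrite mulf_eq0 (negPf z0) sqrf_eq0 => /eqP/nrm_eq0.
Qed.

Section Regularity.
Context {R : realType} {H K : hilbertType R}.
Context {F : set (H * K)} {H0 B : set (H * H)} {U : H -> H}.
Hypotheses (lF : linear_operator F) (cF : closed F) (sH : selfadjoint H0).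
Hypotheses (lB : linear_operator B) (bU : bounded_op U).
Hypothesis (sU : forall e e', hdot (U e) e' = hdot e (U e')).
Hypothesis (form : forall x h b v bv, H0 (x, h) -> B (x, b) -> B (v, bv) ->
  hdot (U b) bv = hdot h v).
Hypothesis (dom : forall x h, H0 (x, h) -> exists b, B (x, b)).
Hypothesis (cFB : rel_compact F B).
Local Notation weak := (weak_solution F B U).

Lemma unperturbed_weak z f k : strong_solution (F := F) H0 z (f, k) ->
  exists u b, weak (fun=> 0) z f u b k.
Proof.
move=> /strong_solutionP[u [g [hg Hu Fu]]].
have [b Bu] := dom Hu; exists u, b; split=> // v bv fv Bv Fv.
by rewrite (form Hu Bu Bv) hdot0l addr0 hdotDl hdotZl (hg _ _ Fv).
Qed.

(** Every solution for [H_0] solves the weak equation for [J] with datum shifted by [J k], whence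
    [k = S T f]. The existence of [T_z] provides the density of the domain of [F^*], and
    self-adjointness of [H_0] a solution for each datum in it. *)
Lemma unperturbed_Tz J z T S : direction J -> Im z != 0 ->
  is_Tz F (form_sum F B U J) z T -> bounded_op S ->
  (forall x, S x - T (J (S x)) = x) -> (forall x, S (x - T (J x)) = x) ->
  is_Tz F H0 z (fun x => S (T x)).
Proof.
move=> dJ z0 hT bS SR SL; have [bT hcl] := hT; have [bJ _] := dJ.
have bST := bounded_comp bS bT; split=> //.
have sub f k : strong_solution (F := F) H0 z (f, k) -> k = S (T f).
  move=> /unperturbed_weak[u [b hw]].
  have := weak_Tz lF cF lB bU sU dJ z0 hT (weak_perturb J hw).
  rewrite sub0r opprK (boundD bT) => e.
  by rewrite -[LHS]SL; congr S; rewrite -{1}e addrK.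
apply/seteqP; split=> [[f k]|[f k]].
  move=> /closureP h; rewrite /op_graph /=.
  have [c c0 hc] := linear_bounded bST.
  apply/eqP; rewrite -subr_eq0; apply/eqP.
  apply: (@nrm_small_zero _ _ _ (1 + c)) => d d0 _.
  have [[f' k'] /= [/sub -> h1 h2]] := h d d0.
  have -> : k - S (T f) = (k - S (T f')) - S (T (f - f')).
    by rewrite (boundB bT) (boundB bS); vec.
  apply: le_trans (nrmB _ _) _; rewrite mulrDr mulr1 lerD ?(ltW h2) //.
  by apply: le_trans (hc _) _; rewrite mulrC ler_wpM2r // ltW.
rewrite /op_graph /= => ->; apply/closureP => e e0 /=.
have [c c0 hc] := linear_bounded bST.
have c1 : 0 < c + 1 by lra.
have d0 : 0 < e / (c + 1) by rewrite divr_gt0.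
have : closure (strong_solution (F := F) (form_sum F B U J) z) (f, T f).
  by rewrite /strong_solution hcl.
move=> /closureP/(_ _ d0)[[f' k'] /= [/strong_solutionP[_ [g [hg _ _]]] h1 _]].
have [u Hu] := nonreal_resolvent sH z0 g.
have [b Bu] := dom Hu; have [k1 Fu] := rel_compact_domain cFB Bu.
have hs : strong_solution (F := F) H0 z (f', k1).
  by apply/strong_solutionP; exists u, g.
have ed : e / (c + 1) * (c + 1) = e by rewrite divfK ?gt_eqF.
exists (f', k1); split=> //=.
  by apply: lt_le_trans h1 _; rewrite ler_pdivrMr // ler_peMr ?(ltW e0) // lerDr.
rewrite (sub _ _ hs) -(boundB bS) -(boundB bT).
apply: le_lt_trans (hc _) _.
have : c * nrm (f - f') <= c * (e / (c + 1)) by rewrite ler_wpM2l // ltW.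
lra.
Qed.

(** Invertibility of [1 - T J] persists for the nearby [T_z J] by a Neumann series. *)
Lemma regular_of_inverse J lam T Y : direction J ->
  is_Tlim F (form_sum F B U J) lam true T -> bounded_op Y ->
  (forall x, Y x - T (J (Y x)) = x) -> (forall x, Y (x - T (J x)) = x) ->
  regular_at F H0 lam.
Proof.
move=> dJ hT bY YR YL; have [bJ _] := dJ; have [bT hlim] := hT.
exists (fun x => Y (T x)); split; first exact: bounded_comp.
move=> _ /pos_real[e e0 ->].
have [t t0 ht] := linear_bounded bT; have [j j0 hj] := linear_bounded bJ.
have [c c0 hc] := linear_bounded bY.
pose q := 1 + j * c + c * (2 + 2 * (j * c * t)).
have jc := mulr_ge0 j0 c0; have jct := mulr_ge0 jc t0.
have cc : 0 <= c * (2 + 2 * (j * c * t)) by apply: mulr_ge0 => //; lra.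
have q1 : 0 < q by rewrite /q; lra.
pose d := Num.min (2^-1 / q) (e / q).
have d0 : 0 < d by rewrite lt_min !divr_gt0.
have dh : d * (j * c) <= 2^-1.
  have : d * q <= 2^-1 by rewrite -ler_pdivlMr // ge_min lexx.
  have : d * (j * c) <= d * q by rewrite ler_wpM2l ?(ltW d0) // /q; lra.
  lra.
have de : d * (c * (2 + 2 * (j * c * t))) <= e.
  have : d * q <= e by rewrite -ler_pdivlMr // ge_min lexx orbT.
  have : d * (c * (2 + 2 * (j * c * t))) <= d * q.
    by rewrite ler_wpM2l ?(ltW d0) // /q; lra.
  lra.
have dc : 0 < d%:C by rewrite ltcR.
have h0 : \forall y \near (0 : R)^'+, 0 < y by exact: nbhs_right_gt.
apply: filterS (filterI h0 (hlim _ dc)) => y [y0 [Tz hTz hop]] /=.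
have hd x : nrm (Tz x - T x) <= d * nrm x by rewrite -lecR rmorphM /= -!nrmE.
have z0 : Im (lam +i* y) != 0 by rewrite /= gt_eqF.
have [bTz _] := hTz.
pose N x := Tz (J (Y x)) - T (J (Y x)).
have bN : bounded_op N by apply: bounded_sub; do 2!apply: bounded_comp => //.
have hN0 x : nrm (N x) <= d * (j * c) * nrm x.
  apply: le_trans (hd _) _; rewrite -mulrA ler_wpM2l ?(ltW d0) //.
  by apply: le_trans (hj _) _; rewrite -mulrA ler_wpM2l.
have hN x : nrm (N x) <= 2^-1 * nrm x.
  by apply: le_trans (hN0 _) _; rewrite ler_wpM2r ?nrm_ge0.
have [S [bS SR SL hS]] := neumann bN hN.
have LY x : Y x - Tz (J (Y x)) = x - N x by rewrite /N -[X in X - (_ - _)](YR x); vec.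
have inj x : x - Tz (J x) = 0 -> x = 0.
  move=> hx; have : Y (Tz (J x) - T (J x)) = x.
    have -> : Tz (J x) - T (J x) = (x - T (J x)) - (x - Tz (J x)) by vec.
    by rewrite hx subr0 YL.
  move=> e'; apply: nrm_eq0.
  have : nrm x <= 2^-1 * nrm x.
    rewrite -{1}e'; apply: le_trans (hc _) _.
    have : d * (j * c) * nrm x <= 2^-1 * nrm x by rewrite ler_wpM2r ?nrm_ge0.
    have : c * nrm (Tz (J x) - T (J x)) <= c * (d * (j * nrm x)).
      by rewrite ler_wpM2l // (le_trans (hd _)) // ler_wpM2l ?(ltW d0).
    lra.
  by have := nrm_ge0 x; lra.
have YSR x : Y (S x) - Tz (J (Y (S x))) = x by rewrite LY SR.
have YSL x : Y (S (x - Tz (J x))) = x.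
  apply/eqP; rewrite -subr_eq0; apply/eqP/inj.
  set w := x - Tz (J x).
  have -> : Y (S w) - x - Tz (J (Y (S w) - x)) = Y (S w) - Tz (J (Y (S w))) - w.
    by rewrite (boundB bJ) (boundB bTz) /w; vec.
  by rewrite YSR subrr.
exists (fun x => Y (S (Tz x))).
  exact: (unperturbed_Tz dJ z0 hTz (bounded_comp bY bS) YSR YSL).
move=> x; rewrite !nrmE -rmorphM lecR /= -(boundB bY).
have -> : S (Tz x) - T x = S (Tz x - T x) + S (N (T x)).
  have := SL (T x); rewrite (boundB bS) => e'.
  by rewrite [S (Tz x - T x)](boundB bS) -[X in _ - X = _]e'; vec.
apply: le_trans (hc _) _.
apply: (@le_trans _ _ (d * (c * (2 + 2 * (j * c * t))) * nrm x)); last first.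
  by rewrite ler_wpM2r ?nrm_ge0.
have h1 := hS (Tz x - T x); have h2 := hS (N (T x)); have h3 := hd x.
have h4 := hN0 (T x).
have h5 : d * (j * c) * nrm (T x) <= d * (j * c) * (t * nrm x).
  by rewrite ler_wpM2l // mulr_ge0 // ltW.
have h6 := nrmD (S (Tz x - T x)) (S (N (T x))).
have : nrm (S (Tz x - T x) + S (N (T x))) <= d * (2 + 2 * (j * c * t)) * nrm x by lra.
move=> /(ler_wpM2l c0) h7; apply: (le_trans h7).
by rewrite le_eqVlt; apply/orP; left; apply/eqP; ring.
Qed.
End Regularity.

(** Otherwise a kernel vector of [1 - C] has preimages under all powers of [1 - C]; the
    generalized kernels then grow strictly, and unit vectors orthogonal to the previous kernel
    have images under [C] at mutual distance at least 1. *)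
Lemma riesz_injective (R : realType) (X : hilbertType R) (C : X -> X) :
  bounded_op C -> clustering C -> (forall y, exists x, x - C x = y) ->
  forall x, x - C x = 0 -> x = 0.
Proof.
move=> bC cC /choice[g hg] x0 hx0; apply: contrapT => /eqP x0n.
pose L x := x - C x.
have bL : bounded_op L by apply: bounded_sub => //; exact: bounded_id.
have bLn n : bounded_op (iter n L).
  elim: n => [|n IH]; first exact: bounded_id.
  exact: (bounded_comp bL IH).
pose N n : set X := [set x | iter n L x = 0].
have sN n : linear_subspace (N n).
  split=> [|a x y hx hy]; rewrite /N /=; first exact: (bound0 (bLn n)).
  by rewrite (boundP (bLn n)) (hx : iter n L x = 0) (hy : iter n L y = 0) scaler0 addr0.
have aN n : adherent (N n) `<=` N n.
  move=> x hx; have [c c0 hc] := linear_bounded (bLn n).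
  apply: (@nrm_small_zero _ _ _ c) => d d0 _; have [m Mm hm] := hx d d0.
  rewrite -[iter n L x]subr0 -(Mm : iter n L m = 0) -(boundB (bLn n)).
  by apply: le_trans (hc _) _; rewrite mulrC ler_wpM2r // ltW.
have NS n m x : (n <= m)%N -> N n x -> N m x.
  by move=> /subnK <- hx; rewrite /N /= iterD (hx : iter n L x = 0) (bound0 (bLn _)).
have NL n x : N n.+1 x -> N n (L x) by rewrite /N /= -iterSr.
pose xs n := iter n g x0.
have hxs n : iter n L (xs n) = x0.
  elim: n => // n IH; rewrite iterSr /xs /= -/(xs n).
  by have -> : L (g (xs n)) = xs n by exact: hg.
have /choice[e he] n : exists e, [/\ N n.+1 e, nrm e = 1 & forall m, N n m -> hdot e m = 0].
  have [m Nm hm] := projection (xs n) (sN n) (aN n).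
  pose v := xs n - m.
  have v0 : nrm v != 0.
    apply: contra x0n => /eqP/nrm_eq0/eqP; rewrite subr_eq0 => /eqP xm.
    by rewrite -(hxs n) xm; apply/eqP.
  have Nv : N n.+1 v.
    apply: (subspaceB (sN n.+1)); last exact: NS Nm.
    by rewrite /N /= hxs.
  exists ((nrm v)^-1%:C *: v); split.
  - exact: subspaceZ.
  - by rewrite nrmZr ger0_norm ?invr_ge0 ?nrm_ge0 // mulVf.
  - by move=> k Nk; rewrite hdotZl hm // mulr0.
have e1 n : nrm (e n) <= 1 by have [_ -> _] := he n.
have [n [m [nm]]] := cC e 1 1 e1 ltr01.
have [Nn n1 _] := he n; have [Nm m1 hm] := he m.
pose w := L (e m) + e n - L (e n).
have Nw : N m w.
  apply: subspaceB => //; first apply: subspaceD => //.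
  - exact: NL.
  - exact: NS Nn.
  - by apply: (NS n) (ltnW nm) _; exact: NL.
have -> : C (e m) - C (e n) = e m - w by rewrite /w /L; vec.
rewrite -(@ltr_sqr _ _ 1) ?nnegrE ?nrm_ge0 // nrmB_sq m1.
by rewrite /rip hm //=; have := sqr_ge0 (nrm w); lra.
Qed.

(** * The residue as a limit of Riemann sums *)

Lemma circle_add (R : realType) (rho a b : R) :
  circle rho (a + b) = circle rho a * circle 1 b.
Proof.
rewrite /circle sinD cosD /= !mul1r; apply/eqP; rewrite eq_complex /=.
by apply/andP; split; apply/eqP; ring.
Qed.

(** [exp(i t) = 1 + i t + o(t)], from the mean value theorem. *)
Lemma circle_tangent (R : realType) (e : R) : 0 < e ->
  exists2 d : R, 0 < d & forall t, 0 < t -> t < d ->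
    `|cos t - 1| <= e * t /\ `|sin t - t| <= e * t.
Proof.
move=> e0.
have /cvgrPdist_lt/(_ _ e0)/nbhs_ballP[d1 /= d10 h1] := @continuous_sin R 0.
have /cvgrPdist_lt/(_ _ e0)/nbhs_ballP[d2 /= d20 h2] := @continuous_cos R 0.
exists (Num.min d1 d2); first by rewrite lt_min d10.
move=> t t0; rewrite lt_min => /andP[t1 t2].
have hb (c d : R) : 0 < c -> c < t -> t < d -> ball (0 : R) d c.
  by move=> c0 ct td; rewrite -ball_normE /= sub0r normrN gtr0_norm //; lra.
have [c hc ec] : exists2 c, c \in `]0, t[%R & cos t - cos 0 = - sin c * (t - 0).
  apply: MVT => //.
  by apply: continuous_subspaceT => x; exact: continuous_cos.
have [c' hc' ec'] : exists2 c, c \in `]0, t[%R & sin t - sin 0 = cos c * (t - 0).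
  apply: MVT => //.
  by apply: continuous_subspaceT => x; exact: continuous_sin.
move: hc hc'; rewrite !in_itv /= => /andP[c0 ct] /andP[c0' ct'].
have /= := h1 c (hb _ _ c0 ct t1); have /= := h2 c' (hb _ _ c0' ct' t2).
rewrite sin0 cos0 sub0r normrN => hcos hsin.
rewrite sin0 cos0 !subr0 in ec ec'.
split; first by rewrite ec normrM normrN (gtr0_norm t0) ler_wpM2r // ltW.
have -> : sin t - t = - (1 - cos c') * t by rewrite ec'; ring.
by rewrite normrM normrN (gtr0_norm t0) ler_wpM2r // ltW.
Qed.

Section Residue.
Context {R : realType} {K : hilbertType R}.
Implicit Types (A : K -> K) (s : R[i]).

Lemma inverse_commutes A s (S : K -> K) : bounded_op A ->
  inverse_op (fun x => x + s *: A x) S -> forall x, S (A x) = A (S x).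
Proof.
move=> bA [bS SL SR] x; rewrite -{1}(SR x) (boundD bA) (boundZ bA).
exact: SL.
Qed.

Lemma inverse_shift A (r : R) s (S : K -> K) : bounded_op A ->
  inverse_op (fun x => x + (s - r%:C) *: A x) S ->
  forall x, S x - r%:C *: A (S x) = x - s *: S (A x).
Proof.
move=> bA hS x; rewrite (inverse_commutes bA hS).
by have [_ _ SR] := hS; rewrite -{3}(SR x); vec.
Qed.

Lemma nrmZi (x : K) : nrm ('i *: x) = nrm x.
Proof. by rewrite nrmZ /= expr0n expr1n add0r sqrtr1 mul1r. Qed.

Lemma nrm_2ipi (x : K) : nrm ((2 * pi%:C * 'i)^-1 *: x) = nrm x / (2 * pi).
Proof.
have pi0 : 0 < 2 * pi :> R by rewrite mulr_gt0 // pi_gt0.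
set y := _ *: x.
have -> : x = (2 * pi)%:C *: ('i *: y).
  have -> : (2 * pi)%:C = 2 * pi%:C :> R[i] by rewrite rmorphM /= rmorph_nat.
  rewrite /y !scalerA divff ?scale1r // !mulf_neq0 ?pnatr_eq0 //.
    by rewrite eq_complex /= (gt_eqF (pi_gt0 R)).
  by rewrite eq_complex /= oner_eq0 andbF.
by rewrite nrmZr nrmZi (gtr0_norm pi0) mulrC mulKf // gt_eqF.
Qed.

(** Dividing the identity [inverse_shift] by [2 pi i s] and integrating over the circle gives
    [(1 - r A) G = 1 - P], since the integral of [1/s] is [2 pi i]. Here [G] is a Riemann sum
    with equal steps, for which [(s_(k+1) - s_k) / s_k] does not depend on [k]. *)
Lemma residue_parametrix A (r rho : R) (S f : R[i] -> K -> K) (I : K -> K) (e : R) :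
  bounded_op A ->
  (forall s, `|s| = rho%:C -> inverse_op (fun x => x + (s - r%:C) *: A x) (S s)) ->
  0 < rho -> (forall s x, `|s| = rho%:C -> f s x = S s (A x)) ->
  is_circle_integral f rho I -> 0 < e ->
  exists G, bounded_op G /\ forall x,
    nrm (x - (2 * pi%:C * 'i)^-1 *: I x - (G x - r%:C *: A (G x))) <= e * nrm x.
Proof.
move=> bA hS rho0 hf [bI hI] e0.
have pi0 : 0 < pi :> R := pi_gt0 R.
have ec : 0 < (e * pi)%:C by rewrite ltcR mulr_gt0.
have [d d0 hd] := hI _ ec.
have e4 : 0 < e / 4 by rewrite divr_gt0.
have [d' d'0 hd'] := circle_tangent e4.
have m0 : 0 < Num.min d d' by rewrite lt_min d0.
have [n0 hn] := archimedean_lt (2 * pi) m0; set n := n0.+1 in hn.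
move: hn; rewrite lt_min => /andP[nd nd'].
set th := 2 * pi / n%:R in nd nd'.
have n0' : 0 < n%:R :> R by rewrite ltr0n.
have th0 : 0 < th by rewrite divr_gt0 // mulr_gt0.
have nth : n%:R * th = 2 * pi by rewrite mulrC divfK // gt_eqF.
have [hcos hsin] := hd' th th0 nd'.
pose t k : R := k%:R * th.
have tS k : t k.+1 = t k + th by rewrite /t -natr1; ring.
have circ a : `|circle rho a| = rho%:C.
  rewrite normc_def /= !exprMn -mulrDr cos2Dsin2 mulr1 sqrtr_sqr gtr0_norm //.
pose ka := (2 * pi%:C * 'i : R[i])^-1.
pose ze := circle 1 th - 1.
pose G x := (ka * ze) *: \sum_(k < n) S (circle rho (t k)) x.
have bG : bounded_op G.
  apply: bounded_scale; apply: (bounded_sum (T := fun k => S (circle rho (t k)))) => k _.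
  by have [] := hS _ (circ (t k)).
exists G; split=> // x.
have tdiff k : circle rho (t k.+1) - circle rho (t k) = ze * circle rho (t k).
  by rewrite tS circle_add /ze; ring.
have hRie : nrm (\sum_(k < n) (ze * circle rho (t k)) *: S (circle rho (t k)) (A x) - I x)
    <= e * pi * nrm x.
  have := hd n t t (mul0r _) nth; rewrite /opnorm_le => h.
  have := h _ x; rewrite !nrmE -rmorphM lecR /= => {}h.
  under eq_bigr => k _ do rewrite -tdiff -hf ?circ //.
  apply: h => k _; split=> //; rewrite tS; first by rewrite lerDl ltW.
  by rewrite addrAC subrr add0r.
have GE : G x - r%:C *: A (G x) = ka *: ((ze * n%:R) *: x -
    \sum_(k < n) (ze * circle rho (t k)) *: S (circle rho (t k)) (A x)).
  pose L y := y - r%:C *: A y.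
  have bL : bounded_op L.
    by apply: bounded_sub; [exact: bounded_id|exact: bounded_scale].
  rewrite -/(L (G x)) /G (boundZ bL) -[(ka * ze) *: _]scalerA; congr (_ *: _).
  have -> : L (\sum_(k < n) S (circle rho (t k)) x) =
      \sum_(k < n) L (S (circle rho (t k)) x).
    by elim/big_ind2: _ => [|? ? ? ? <- <-|//]; rewrite ?(bound0 bL) ?(boundD bL).
  under eq_bigr => k _ do rewrite /L (inverse_shift bA (hS _ (circ (t k)))).
  rewrite sumrB sumr_const card_ord scalerBr scaler_sumr -scaler_nat scalerA.
  by congr (_ - _); apply: eq_bigr => k _; rewrite scalerA.
have split_error : x - ka *: I x - (G x - r%:C *: A (G x)) =
    ka *: (\sum_(k < n) (ze * circle rho (t k)) *: S (circle rho (t k)) (A x) - I x) -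
    ka *: (n%:R *: ((ze - 'i * th%:C) *: x)).
  have ka1 : ka * (n%:R * ('i * th%:C)) = 1.
    have -> : n%:R * ('i * th%:C) = 2 * pi%:C * 'i :> R[i].
      by rewrite mulrCA -(rmorph_nat (real_complex R)) -rmorphM nth rmorphM rmorph_nat mulrC.
    rewrite mulVf // !mulf_neq0 ?pnatr_eq0 //; first by rewrite eq_complex /= gt_eqF.
    by rewrite eq_complex /= oner_eq0 andbF.
  have xE : x = (ka * (n%:R * ('i * th%:C))) *: x by rewrite ka1 scale1r.
  by rewrite GE [X in X - ka *: I x]xE; vec.
have htan : nrm ((ze - 'i * th%:C) *: x) <= e / 2 * th * nrm x.
  have -> : (ze - 'i * th%:C) *: x =
      (cos th - 1)%:C *: x + 'i *: ((sin th - th)%:C *: x).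
    rewrite scalerA -scalerDl; congr (_ *: _); rewrite /ze /circle !mul1r.
    apply/eqP; rewrite eq_complex /=.
    by apply/andP; split; apply/eqP; ring.
  apply: le_trans (nrmD _ _) _; rewrite nrmZi !nrmZr -mulrDl ler_wpM2r ?nrm_ge0 //.
  lra.
rewrite split_error; apply: le_trans (nrmB _ _) _; rewrite !nrm_2ipi.
have -> : nrm (n%:R *: ((ze - 'i * th%:C) *: x)) = n%:R * nrm ((ze - 'i * th%:C) *: x).
  by rewrite -(rmorph_nat (real_complex R)) nrmZr normr_nat.
rewrite -mulrDl ler_pdivrMr ?mulr_gt0 //.
have : n%:R * nrm ((ze - 'i * th%:C) *: x) <= n%:R * (e / 2 * th * nrm x).
  by rewrite ler_wpM2l ?(ltW n0').
have -> : n%:R * (e / 2 * th * nrm x) = e / 2 * (n%:R * th) * nrm x by ring.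
rewrite nth; lra.
Qed.
End Residue.

(** * The non-regular direction *)

(** With [L = 1 - r A] and [E = 1 - P - L G] small, the hypothesis on [Z] reads
    [(L + t A (L G + E)) Z = 1]. As [A] commutes with [L], this is
    [L (1 + t A G) Z = 1 - t A E Z], and the right-hand side is invertible. *)
Lemma parametrix_right_inverse (R : realType) (K : hilbertType R) (A P Z : K -> K)
    (r t : R) : bounded_op A -> bounded_op Z ->
  (forall x, Z x - r%:C *: A (Z x) + t%:C *: A (Z x - P (Z x)) = x) ->
  (forall e : R, 0 < e -> exists G, bounded_op G /\ forall x,
     nrm (x - P x - (G x - r%:C *: A (G x))) <= e * nrm x) ->
  exists2 Y, bounded_op Y & forall y, Y y - r%:C *: A (Y y) = y.
Proof.
move=> bA bZ hZ hP.
have [a a0 ha] := linear_bounded bA; have [c c0 hc] := linear_bounded bZ.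
have q0 : 0 <= `|t| * (a * c) by rewrite !mulr_ge0.
pose e := 2^-1 / (`|t| * (a * c) + 1).
have e0 : 0 < e by rewrite divr_gt0 //; lra.
have eq : `|t| * (a * c) * e <= 2^-1.
  have : e * (`|t| * (a * c) + 1) = 2^-1 by rewrite /e divfK // gt_eqF //; lra.
  lra.
have [G [bG hG]] := hP e e0.
pose L x := x - r%:C *: A x.
have bL : bounded_op L by apply: bounded_sub; [exact: bounded_id|exact: bounded_scale].
pose V y := Z y + t%:C *: A (G (Z y)).
have bV : bounded_op V.
  apply: bounded_add => //; apply: bounded_scale.
  exact: (bounded_comp bA (bounded_comp bG bZ)).
pose N y := y - L (V y).
have bN : bounded_op N.
  by apply: bounded_sub; [exact: bounded_id|exact: bounded_comp].
have NE y : N y = t%:C *: A (Z y - P (Z y) - (G (Z y) - r%:C *: A (G (Z y)))).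
  rewrite /N /L /V -{1}(hZ y) !(boundD bA, boundN bA, boundZ bA); vec.
have hN y : nrm (N y) <= 2^-1 * nrm y.
  rewrite NE nrmZr.
  have h1 := ha (Z y - P (Z y) - (G (Z y) - r%:C *: A (G (Z y)))).
  have h2 : a * nrm (Z y - P (Z y) - (G (Z y) - r%:C *: A (G (Z y)))) <=
      a * (e * nrm (Z y)) by rewrite ler_wpM2l.
  have h3 : a * (e * nrm (Z y)) <= a * (e * (c * nrm y)).
    by do 2 (rewrite ler_wpM2l ?(ltW e0) //).
  have := le_trans h1 (le_trans h2 h3) => /(ler_wpM2l (normr_ge0 t)).
  have : `|t| * (a * c) * e * nrm y <= 2^-1 * nrm y by rewrite ler_wpM2r ?nrm_ge0.
  lra.
have [S [bS SR _ _]] := neumann bN hN.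
exists (fun y => V (S y)); first exact: bounded_comp.
by move=> y; rewrite -{3}(SR y) /N /L; vec.
Qed.

Lemma clustering_comp (R : realType) (X Y Z : hilbertType R) (T : Y -> Z) (J : X -> Y) :
  clustering T -> bounded_op J -> clustering (fun x => T (J x)).
Proof.
move=> cT bJ e M d hM d0; have [c c0 hc] := linear_bounded bJ.
apply: (cT (fun n => J (e n)) (c * M)) => // n.
by apply: le_trans (hc _) _; rewrite ler_wpM2l.
Qed.

Theorem theorem3p9 (R : realType) (H K : hilbertType R)
    (F : set (H * K)) (H0 B : set (H * H)) (U : H -> H)
    (lam : R) (J P : K -> K) :
  rigging F ->
  selfadjoint H0 ->
  form_data H0 B U ->
  rel_compact F B ->
  essential_spectrum H0 lam%:C ->
  semi_regular F B U lam ->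
  resonant_at F H0 lam ->
  direction J ->
  regular_direction F B U lam J ->
  property_S F B U lam J ->
  is_P F B U lam true J P ->
  ~ regular_direction F B U lam (fun x => J x - (J \o P) x).
Proof.
move=> [lF cF _ _ _] sH hform cFB _ _ hres [bJ sJ] _ _ hP [t [T' hT']]; apply: hres.
have [sB bU sU [UB UU form dom]] := form_dataP sH hform; have lB := sa_linear sB.
case: hP => r [T [rho [f [I [hT rho0 _ hf [hI PE]]]]]].
have [bT _] := hT; have [bT' _] := hT'; have [bI _] := hI.
pose A x := T (J x); have bA : bounded_op A by exact: bounded_comp.
pose Jr x := r%:C *: J x; pose Jt x := t%:C *: (J x - J (P x)).
have bP : bounded_op P by rewrite PE; exact: bounded_scale.
have bJr : bounded_op Jr by exact: bounded_scale.
have bJt : bounded_op Jt.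
  by apply: bounded_scale; apply: bounded_sub => //; exact: bounded_comp.
have dJr : direction Jr.
  split=> // x y; rewrite /Jr hdotZl hdotZr sJ; congr (_ * _).
  exact/esym/conjc_real.
have TE x : r%:C *: A x = T (Jr x) by rewrite /A /Jr (boundZ bT).
(* The resolvent identity [T - T' = T D T'] gives [(1 + T D) (1 - T' D) = 1]. *)
pose D x := Jt x - Jr x; have bD : bounded_op D by exact: bounded_sub.
pose Z x := x - T' (D x).
have bZ : bounded_op Z.
  by apply: bounded_sub; [exact: bounded_id|exact: bounded_comp].
have hZ x : Z x - r%:C *: A (Z x) + t%:C *: A (Z x - P (Z x)) = x.
  have := limit_identity lF cF lB bU sU dJr bJt hT hT' (D x).
  rewrite -/(D (T' (D x))) -(boundB bD) -/(Z x) => e.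
  have -> : t%:C *: A (Z x - P (Z x)) = T (Jt (Z x)).
    by rewrite /Jt (boundZ bT) /A (boundB bJ).
  rewrite TE -addrA [- _ + _]addrC -(boundB bT) -/(D (Z x)) e.
  by rewrite /Z subrK.
have par (e : R) : 0 < e -> exists G, bounded_op G /\ forall x,
     nrm (x - P x - (G x - r%:C *: A (G x))) <= e * nrm x.
  move=> e0.
  have hS0 s : exists S, `|s| = rho%:C ->
      inverse_op (fun x => x + (s - r%:C) *: A x) S /\ f s = S \o T.
    case: (pselect (`|s| = rho%:C)) => [/hf[S hS fE]|ns]; first by exists S.
    by exists id => /ns.
  have [S hS] := choice hS0.
  have := residue_parametrix bA (fun s hs => (hS s hs).1) rho0 _ hI e0.
  case=> [s x /hS[_ ->] //|G [bG hG]].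
  by exists G; split=> // x; rewrite PE; exact: hG.
have [Y bY YR] := parametrix_right_inverse bA bZ hZ par.
have YR' x : Y x - T (Jr (Y x)) = x by rewrite -TE.
have cT : clustering (fun x => T (Jr x)).
  exact: clustering_comp (Tlim_clustering lF lB bU sU UB UU cFB dJr hT) bJr.
have bTJ : bounded_op (fun x => T (Jr x)) by exact: bounded_comp.
have inj := riesz_injective bTJ cT (fun y => ex_intro _ (Y y) (YR' y)).
apply: (regular_of_inverse lF cF sH lB bU sU form dom cFB dJr hT bY YR') => x.
apply/eqP; rewrite -subr_eq0; apply/eqP/inj.
set w := x - T (Jr x).
have -> : Y w - x - T (Jr (Y w - x)) = Y w - T (Jr (Y w)) - w.
  by rewrite (boundB bJr) (boundB bT) /w; vec.
by rewrite YR' subrr.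
Qed.
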